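(* Cardinality-Constrained Cluster Deletion is solvable in polynomial time on instances $(G,k,\gamma_1,\gamma_2)$ in which $G$ is a cluster graph.
   Context: A cluster graph is a graph in which every connected component is a clique. For integers $\gamma_1,\gamma_2\ge1$, a graph is $(\gamma_1,\gamma_2)$-cardinality-constrained if every connected component $H$ satisfies $\gamma_1\le|V(H)|\le\gamma_2$. Cardinality-Constrained Cluster Deletion: given a graph $G$ and non-negative integers $\gamma_1,\gamma_2,k$, decide whether there is $F\subseteq E(G)$ with $|F|\le k$ such that $(V(G),E(G)\setminus F)$ is a $(\gamma_1,\gamma_2)$-cardinality-constrained cluster graph. *)

(* Defs.v *)
From mathcomp Require Import all_boot all_order all_algebra.

Set Implicit Arguments.
Unset Strict Implicit.
Unset Printing Implicit Defensive.

Record sgraph (T : finType) := SGraph {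
  adj :> rel T;
  adj_sym : symmetric adj;
  adj_irr : irreflexive adj }.

Section Graphs.
Variable T : finType.
Implicit Types (G : sgraph T) (F : {set {set T}}) (H : {set T}).

Definition edges G : {set {set T}} :=
  [set A : {set T} | [exists x, exists y, adj G x y && (A == [set x; y])]].

Definition del_rel G F : rel T :=
  fun x y => adj G x y && ([set x; y] \notin F).

Fact del_rel_sym G F : symmetric (del_rel G F).
Proof. by move=> x y; rewrite /del_rel adj_sym setUC. Qed.

Fact del_rel_irr G F : irreflexive (del_rel G F).
Proof. by move=> x; rewrite /del_rel adj_irr. Qed.

(* The graph (V(G), E(G) \ F). *)
Definition del_edges G F : sgraph T :=
  SGraph (del_rel_sym G F) (del_rel_irr G F).

Definition components G : {set {set T}} :=
  [set [set y | connect (adj G) x y] | x : T].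

Definition clique G H : Prop :=
  forall x y, x \in H -> y \in H -> x != y -> adj G x y.

Definition cluster_graph G : Prop :=
  forall H, H \in components G -> clique G H.

Definition card_constrained (gamma1 gamma2 : nat) G : Prop :=
  forall H, H \in components G -> gamma1 <= #|H| <= gamma2.

End Graphs.

Record cccd_instance := CCCDInstance {
  nverts : nat;
  graph : sgraph 'I_nverts;
  budget : nat;
  gamma1 : nat;
  gamma2 : nat }.

Definition cccd_yes (I : cccd_instance) : Prop :=
  exists F : {set {set 'I_(nverts I)}},
    [/\ F \subset edges (graph I), #|F| <= budget I,
        cluster_graph (del_edges (graph I) F)
      & card_constrained (gamma1 I) (gamma2 I) (del_edges (graph I) F)].

(* Instances are words over {0, 1, #}; None is the separator #. *)
Definition letter := option bool.

(* Binary expansion, least significant bit first; bits 0 = [:: false]. *)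
Definition bits (n : nat) : seq bool :=
  mkseq (fun i => odd (n %/ 2 ^ i)) (trunc_log 2 n).+1.

Definition delimit (s : seq bool) : seq letter := rcons (map Some s) None.

Definition adj_row n (G : sgraph 'I_n) (i : 'I_n) : seq bool :=
  [seq adj G i j | j <- enum 'I_n].

(* bits k # bits gamma1 # bits gamma2 # row_0 # ... # row_(n-1) #,
   where the rows are those of the adjacency matrix. *)
Definition encode_cccd (I : cccd_instance) : seq letter :=
  delimit (bits (budget I)) ++ delimit (bits (gamma1 I)) ++
  delimit (bits (gamma2 I)) ++
  flatten [seq delimit (adj_row (graph I) i) | i <- enum 'I_(nverts I)].

(* Deterministic multitape Turing machines. Tapes are infinite to the right
   only, and a left move from cell 0 leaves the head in place. A cell is blank
   (None), or holds an input letter or an auxiliary symbol. *)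
Inductive move := MoveLeft | Stay | MoveRight.

Definition move_head (m : move) (p : nat) : nat :=
  match m with MoveLeft => p.-1 | Stay => p | MoveRight => p.+1 end.

Record tm (Sigma : finType) := TM {
  extra_tapes : nat;
  state : finType;
  aux : finType;
  start : state;
  (* Some b: halting state with answer b; None: running state. *)
  verdict : state -> option bool;
  trans : state -> {ffun 'I_extra_tapes.+1 -> option (Sigma + aux)} ->
          state * ('I_extra_tapes.+1 -> option (Sigma + aux) * move) }.

Section Semantics.
Variables (Sigma : finType) (M : tm Sigma).

Definition cell : finType := option (Sigma + aux M).

Record tape := Tape { content : nat -> cell; head_pos : nat }.

Record config := Config {
  cur_state : state M;
  tapes : 'I_(extra_tapes M).+1 -> tape }.

Definition act (t : tape) (a : cell * move) : tape :=
  Tape (fun p => if p == head_pos t then a.1 else content t p)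
       (move_head a.2 (head_pos t)).

(* Halting configurations are fixed points. *)
Definition step (c : config) : config :=
  if verdict (cur_state c) is Some _ then c else
  let r := trans (cur_state c)
             [ffun i => content (tapes c i) (head_pos (tapes c i))] in
  Config r.1 (fun i => act (tapes c i) (r.2 i)).

(* The input is on cells 0, ..., size w - 1 of tape 0; all else is blank. *)
Definition init (w : seq Sigma) : config :=
  Config (start M) (fun i =>
    Tape (fun p => if i == ord0 then nth None [seq Some (inl a) | a <- w] p
                   else None) 0).

Definition answers_within (w : seq Sigma) (t : nat) (b : bool) : Prop :=
  verdict (cur_state (iter t step (init w))) = Some b.

End Semantics.

(* Decidability in polynomial time of the problem yes, with instances encoded
   by enc, on the class C of instances: nothing is required outside C. *)
Definition poly_time_solvable_on (Inst : Type) (Sigma : finType)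
    (enc : Inst -> seq Sigma) (yes C : Inst -> Prop) : Prop :=
  exists (M : tm Sigma) (p : {poly nat}),
    forall I : Inst, C I ->
      exists b : bool,
        answers_within M (enc I) (p.[size (enc I)])%R b /\ (b <-> yes I).

(* Main.v *)
Require Import Defs.
From mathcomp Require Import all_boot all_order all_algebra.
From mathcomp Require Import zify.
From Stdlib Require Import FunctionalExtensionality.

Set Implicit Arguments.
Unset Strict Implicit.
Unset Printing Implicit Defensive.

(** In a cluster graph the problem splits over the cliques. A clique on [n]
vertices is cut into parts of sizes [s_i] in [[a, b]], and twice the number of
deleted edges is [n^2 - sum s_i^2]. Writing [s_i = a + x_i], a solution with
[m] parts has [sum s_i^2 = 2 a n - m a^2 + sum x_i^2], where [0 <= x_i <= b - a]
and [sum x_i = n - m a]. The last sum is largest when all but one of the [x_i]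
are [0] or [b - a]; this maximum is a superadditive function of [sum x_i], so
the bound decreases with [m] and the least possible [m], the ceiling of [n / b],
is optimal. Sorting the vertices of a clique, a vertex of rank [r] loses as many
edges to smaller vertices as the start of the part that contains [r], which
gives the total by scanning the rows of the adjacency matrix.

For the running time, consider programs over counters with values in [[0, N]],
[N] being the length of the input, whose only loop repeats its body [N] times.
Such a program runs on a multitape machine, a counter being a head position
between two end marks, within a number of steps that is a polynomial in [N] by
structural recursion. *)

(** * Optimal part sizes *)

(** Greedy distribution: each of the [m] parts receives [a], and the excess [e] is handed out in
    portions of at most [c], so at most one portion lies strictly between [0] and [c]. *)
Fixpoint parts (a c m e : nat) : seq nat :=
  if m is m'.+1 then (a + minn c e) :: parts a c m' (e - c) else [::].

(** The first position of the block containing [r], when an initial segment of the integers is cut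
    into consecutive blocks of lengths [l]. *)
Fixpoint start (l : seq nat) (r : nat) : nat :=
  if l is s :: l' then if r < s then 0 else s + start l' (r - s) else 0.

Definition nparts (b n : nat) : nat := (n + b.-1) %/ b.

(** More parts only make the lower bound harder to meet, so the least number of parts is tested.
    Division by [0] gives [0], hence the separate condition on [b]. *)
Definition feasible (a b n : nat) : bool := (0 < b) && (nparts b n * a <= n).

Definition sizes (a b n : nat) : seq nat :=
  parts a (b - a) (nparts b n) (n - nparts b n * a).

Lemma nparts_le b n m : 0 < b -> (nparts b n <= m) = (n <= m * b).
Proof.
move=> b0; rewrite /nparts -ltnS ltn_divLR // mulSn.
by rewrite -(ltn_add2l b.-1); apply/idP/idP; lia.
Qed.

Lemma nparts_gt b n m : 0 < b -> (m < nparts b n) = (m * b < n).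
Proof. by move=> b0; rewrite !ltnNge nparts_le. Qed.

Lemma nparts_ub b n : 0 < b -> n <= nparts b n * b.
Proof. by move=> b0; rewrite -nparts_le. Qed.

Lemma sumn_parts a c m e : sumn (parts a c m e) = m * a + minn (m * c) e.
Proof.
elim: m e => [|m IH] e /=; first by rewrite !mul0n min0n.
by rewrite IH !mulSn; lia.
Qed.

Lemma feasible_le a b n : 0 < n -> feasible a b n -> a <= b.
Proof.
move=> n0 /andP [b0 h]; have h' := nparts_ub n b0.
have m0 : 0 < nparts b n by rewrite nparts_gt.
by rewrite -(leq_pmul2l m0) (leq_trans h).
Qed.

Lemma sumn_sizes a b n : feasible a b n -> sumn (sizes a b n) = n.
Proof.
case/andP=> b0 h; rewrite sumn_parts mulnBr.
by have := nparts_ub n b0; lia.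
Qed.

Lemma start_le l r : start l r <= r.
Proof.
elim: l r => //= s l IH r; case: ltnP => // h.
by have := IH (r - s); lia.
Qed.

(** * Sums of squares and their maximum *)

Definition sumsq (l : seq nat) : nat := \sum_(s <- l) s * s.

Lemma sumsq_cons s l : sumsq (s :: l) = s * s + sumsq l.
Proof. by rewrite /sumsq big_cons. Qed.

(* The largest sum of squares of numbers in [0, c] with sum e. *)
Definition hump (c e : nat) : nat := (e %/ c) * (c * c) + (e %% c) * (e %% c).

Lemma hump_small c x : x <= c -> hump c x = x * x.
Proof.
rewrite /hump leq_eqVlt => /orP [/eqP ->|h]; last first.
  by rewrite divn_small // modn_small.
case: c => [|c]; first by rewrite divn0.
by rewrite divnn modnn /= mul1n addn0.
Qed.

Lemma hump_shift c e : c <= e -> hump c e = c * c + hump c (e - c).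
Proof.
case: c => [|c] h; first by rewrite subn0.
rewrite /hump -{1 2 3}(subnK h) divnDr // divnn modnDr /=.
by nia.
Qed.

(** If the remainders [r1], [r2] sum to less than [c], they merge into one square. Otherwise a full
    [c] splits off, and the gain is [2 (c - r1) (c - r2)]. *)
Lemma hump_add c x y : hump c x + hump c y <= hump c (x + y).
Proof.
case: c => [|c]; first by rewrite /hump !divn0 !modn0; nia.
rewrite /hump; move: (divn_eq x c.+1) (divn_eq y c.+1).
have := ltn_pmod x (ltn0Sn c); have := ltn_pmod y (ltn0Sn c).
move: (x %/ _) (y %/ _) (x %% _) (y %% _) => q1 q2 r1 r2 h2 h1 -> ->.
have [h|h] := ltnP (r1 + r2) c.+1.
  have -> : q1 * c.+1 + r1 + (q2 * c.+1 + r2) = (q1 + q2) * c.+1 + (r1 + r2) by lia.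
  by rewrite divnMDl // modnMDl divn_small // modn_small //; nia.
have -> : q1 * c.+1 + r1 + (q2 * c.+1 + r2) =
    (q1 + q2).+1 * c.+1 + (r1 + r2 - c.+1) by lia.
rewrite divnMDl // modnMDl divn_small ?modn_small; try lia.
by nia.
Qed.

(** For [s = a + x] one has [s^2 + a^2 = 2 a s + x^2]; the squares [x^2] are collected by
    superadditivity of [hump]. *)
Lemma sumsq_le a b l : all (fun s => a <= s <= b) l ->
  size l * a <= sumn l <= size l * b /\
  sumsq l + size l * (a * a) <=
    2 * a * sumn l + hump (b - a) (sumn l - size l * a).
Proof.
elim: l => [|s l IH] /=; first by rewrite /sumsq big_nil.
case/andP=> /andP [h1 h2] /IH [/andP [h3 h4] h5]; rewrite sumsq_cons !mulSn.
split; first by lia.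
have := hump_add (b - a) (s - a) (sumn l - size l * a).
rewrite (hump_small (leq_sub2r a h2)).
have -> : s - a + (sumn l - size l * a) = s + sumn l - (a + size l * a) by lia.
move: (hump _ _) (hump _ _) h5 => u v h5 h6.
by nia.
Qed.

Lemma sumsq_parts a c m e : e <= m * c ->
  sumsq (parts a c m e) + m * (a * a) = 2 * a * (m * a + e) + hump c e.
Proof.
elim: m e => [|m IH] e /=.
  rewrite mul0n leqn0 => /eqP ->; rewrite /sumsq big_nil hump_small //.
  by rewrite !muln0.
move=> he; rewrite sumsq_cons; have [h|h] := leqP c e.
  have := IH (e - c); rewrite (hump_shift h) => /(_ _); nia.
have -> : e - c = 0 by lia.
have := IH 0 (leq0n _); rewrite !hump_small //; last exact: ltnW.
by nia.
Qed.

Lemma sizes_optimal a b l : 0 < b -> all (fun s => a <= s <= b) l ->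
  feasible a b (sumn l) /\ sumsq l <= sumsq (sizes a b (sumn l)).
Proof.
move=> b0 /sumsq_le [/andP [h1 h2] h3].
have hm : nparts b (sumn l) <= size l by rewrite nparts_le.
have feas : nparts b (sumn l) * a <= sumn l.
  by apply: leq_trans h1; rewrite leq_mul2r hm orbT.
split; first by rewrite /feasible b0.
have := nparts_ub (sumn l) b0; rewrite /sizes.
move: (nparts b _) hm feas => m hm feas hb.
have := @sumsq_parts a (b - a) m (sumn l - m * a).
rewrite mulnBr leq_sub2r // subnKC // => /(_ isT).
(* Going down from [size l] to [m] parts frees [(size l - m) * a] units of excess, so the [hump]
   term does not decrease, while the subtracted multiple of [a * a] does not increase. *)
have := hump_add (b - a) (sumn l - size l * a) ((size l - m) * a).
have -> : sumn l - size l * a + (size l - m) * a = sumn l - m * a by nia.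
have : m * (a * a) <= size l * (a * a) by rewrite leq_mul2r hm orbT.
by lia.
Qed.

(** [start l r] counts the positions in blocks before that of [r]. Summed and doubled, this gives
    the ordered pairs from distinct blocks; [sumsq l] counts those within a block. *)
Lemma sum_start l : 2 * (\sum_(r < sumn l) start l r) + sumsq l = sumn l * sumn l.
Proof.
elim: l => [|s l IH]; first by rewrite /sumsq big_nil big_ord0.
rewrite sumsq_cons [sumn _]/= big_split_ord big1 => [|r _]; last first.
  by rewrite /= ltn_ord.
rewrite (eq_bigr (fun r : 'I_(sumn l) => s + start l r)) => [|r _]; last first.
  by rewrite /= ltnNge leq_addr /= addKn.
rewrite big_split sum_nat_const card_ord /= in IH *.
by nia.
Qed.

(** The length of the block of [r], counted as the number of positions with the same [start], which
    is how the vertices of a part are recognised below. *)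
Definition fiber l r := \sum_(r' < sumn l) (start l r' == start l r).

Lemma fiber_lt s l r : r < s -> fiber (s :: l) r = s.
Proof.
move=> h; rewrite /fiber [sumn _]/= big_split_ord /= (eq_bigr (fun _ => 1)).
  rewrite sum_nat_const card_ord muln1 big1 ?addn0 // => r' _ /=.
  by rewrite h ltnNge leq_addr /= addKn; case: s h.
by move=> r' _; rewrite /= h ltn_ord.
Qed.

Lemma fiber_ge s l r : s <= r -> fiber (s :: l) r = fiber l (r - s).
Proof.
move=> h; rewrite /fiber [sumn _]/= big_split_ord /= big1 => [|r' _]; last first.
  rewrite /= ltn_ord ltnNge h /=.
  by case: s h r' => [|s] h [].
rewrite add0n; apply: eq_bigr => r' _ /=.
by rewrite !ltnNge leq_addr h /= addKn eqn_add2l.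
Qed.

Lemma fiber_mem l r : r < sumn l -> fiber l r \in l.
Proof.
elim: l r => // s l IH r; rewrite [sumn _]/= inE => hr.
have [h|h] := ltnP r s; first by rewrite fiber_lt ?eqxx.
by rewrite fiber_ge // IH ?orbT //; lia.
Qed.

Lemma sum_fiber l : \sum_(r < sumn l) fiber l r = sumsq l.
Proof.
elim: l => [|s l IH]; first by rewrite /sumsq big_nil big_ord0.
rewrite sumsq_cons [X in \sum_(r < X) _]/= big_split_ord; congr (_ + _).
  rewrite -[X in _ = X * _]card_ord -sum_nat_const; apply: eq_bigr => r _.
  by apply: fiber_lt; exact: (ltn_ord r).
by rewrite -IH; apply: eq_bigr => r _; rewrite fiber_ge /= ?leq_addr ?addKn.
Qed.

(** * Deletion sets of cluster graphs *)

Section Classes.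
Variable T : finType.
Implicit Types (R : rel T) (C : {set T}).

Definition classes R : {set {set T}} := equivalence_partition R [set: T].

Lemma class_eq R C x : equivalence_rel R -> C \in classes R -> x \in C ->
  C = [set y | R x y].
Proof.
move=> eR /imsetP [z _ ->]; rewrite inE => /andP [_ zx].
apply/setP => y; rewrite !inE /=.
by have [_ h] := eR z x y; rewrite h.
Qed.

Lemma sum_classes R (f : T -> nat) : equivalence_rel R ->
  \sum_x f x = \sum_(C in classes R) \sum_(x in C) f x.
Proof.
move=> eR; have part : partition (classes R) [set: T].
  by apply: equivalence_partitionP => x y z _ _ _; apply: eR.
rewrite -(set_partition_big _ part) /=.
by apply: eq_bigl => x; rewrite inE.
Qed.

(** [R'] cuts the class [C] into parts, and summing over [x] in [C] the size of the part of [x]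
    gives the sum of squares of the part sizes, to which [sizes_optimal] applies. *)
Lemma class_refinement R R' C a b : equivalence_rel R -> equivalence_rel R' ->
  subrel R' R -> C \in classes R ->
  (forall x, x \in C -> a <= #|[set y | R' x y]| <= b) -> C != set0 ->
  feasible a b #|C| /\
  \sum_(x in C) #|[set y | R' x y]| <= sumsq (sizes a b #|C|).
Proof.
move=> eR eR' sub hC hab nC.
pose Q := equivalence_partition R' C.
have part : partition Q C.
  by apply: equivalence_partitionP => x y z _ _ _; apply: eR'.
have QE D x : D \in Q -> x \in D -> x \in C /\ D = [set y | R' x y].
  case/imsetP=> z zC ->; rewrite inE => /andP [xC zx]; split=> //.
  apply/setP => y; rewrite !inE.
  have [_ h] := eR' z x y; rewrite h // andb_idl // => /sub xy.
  by rewrite (class_eq eR hC xC) inE.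
have ne D : D \in Q -> exists x, x \in D.
  move=> DQ; apply/set0Pn; apply: contraTneq DQ => ->.
  by case/and3P: part.
pose l := [seq #|D : {set T}| | D <- enum Q].
have sl : sumn l = #|C|.
  by rewrite sumnE big_map big_enum (card_partition part).
have hl : all (fun s => a <= s <= b) l.
  apply/allP => s /mapP [D]; rewrite mem_enum => DQ ->.
  by have [x xD] := ne D DQ; have [xC ->] := QE D x DQ xD; apply: hab.
have b0 : 0 < b.
  have /set0Pn [x xC] := nC; have /andP [_] := hab x xC; apply: leq_trans.
  by rewrite (cardD1 x) inE (eR' x x x).1.
have [fe opt] := sizes_optimal b0 hl; rewrite sl in fe opt; split=> //.
apply: leq_trans opt; rewrite (set_partition_big _ part) /= /sumsq big_map big_enum.
apply: leq_sum => D DQ; rewrite -sum_nat_const; apply: eq_leq.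
by apply: eq_bigr => x xD; have [_ <-] := QE D x DQ xD.
Qed.

End Classes.

(** The ranks of the elements of [C] are [0, ..., #|C| - 1], each taken once. The induction removes
    the maximum, which leaves the other ranks unchanged. *)
Lemma sum_rank n (C : {set 'I_n}) (g : nat -> nat) :
  \sum_(x in C) g #|[set y in C | y < x]| = \sum_(r < #|C|) g r.
Proof.
move eC: #|C| => c; elim: c C eC => [|c IH] C eC.
  by rewrite big_ord0 (cards0_eq eC) big_set0.
have /set0Pn [x0 x0C] : C != set0 by rewrite -card_gt0 eC.
have [m' mC' hm'] := arg_maxnP (fun x : 'I_n => x : nat) x0C.
have [m mC hm] : exists2 m, m \in C & forall x : 'I_n, x \in C -> x <= m by exists m'.
have eC' : #|C :\ m| = c by move: eC; rewrite (cardsD1 m) mC => -[].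
rewrite (big_setD1 m mC) big_ord_recr /= addnC -(IH _ eC'); congr (_ + _).
  apply: eq_bigr => x; rewrite !inE => /andP [xm xC]; congr (g _).
  apply: eq_card => y; rewrite !inE; case: eqP => //= ->.
  by rewrite [m < x]ltnNge [x <= m]hm //= andbF.
congr (g _); rewrite -eC'; apply: eq_card => y; rewrite !inE andbC.
case yC: (y \in C); rewrite ?andbF // !andbT ltn_neqAle.
by rewrite [y <= m]hm // andbT.
Qed.

(** * Counting deleted edges in a cluster graph *)

Section Cluster.
Variable n : nat.
Implicit Types (G : sgraph 'I_n) (F : {set {set 'I_n}}).

Definition same G : rel 'I_n := fun x y => (x == y) || adj G x y.

Lemma cluster_connect G : cluster_graph G -> connect (adj G) =2 same G.
Proof.
move=> cG x y; apply/idP/orP => [xy|[/eqP ->|/connect1 //]]; last exact: connect0.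
case: eqVneq => [->|xy']; [by left | right].
apply: (cG [set z | connect (adj G) x z]); rewrite ?inE ?connect0 //.
exact: imset_f.
Qed.

Lemma connect_equiv G : equivalence_rel (connect (adj G)).
Proof.
apply/equivalence_relP; split=> [x|x y xy]; first exact: connect0.
move=> z; apply: same_connect => //.
by apply: sym_connect_sym; apply: adj_sym.
Qed.

Lemma same_equiv G : cluster_graph G -> equivalence_rel (same G).
Proof.
by move=> cG x y z; have := connect_equiv G x y z; rewrite !cluster_connect.
Qed.

(** By transitivity a path shrinks to a single edge or a single vertex. *)
Lemma equiv_cluster G : equivalence_rel (same G) -> cluster_graph G.
Proof.
move=> eG H /imsetP [x _ ->] y z; rewrite !inE => xy xz yz.
have sub : forall u v, connect (adj G) u v -> same G u v.
  move=> u v /connectP [p + ->]; elim: p u => /= [|u' p IH] u.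
    by rewrite /same eqxx.
  case/andP=> uu' /IH; have [_ ->] := eG u u' (last u' p) => //.
  by rewrite /same uu' orbT.
have : same G y z by have [_ <-] := eG x y z; apply: sub.
by rewrite /same (negPf yz).
Qed.

(** Double counting: each member of [F] arises from exactly two ordered pairs of adjacent
    vertices. *)
Lemma card_deleted G F : F \subset edges G ->
  2 * #|F| = \sum_x #|[set y | adj G x y && ([set x; y] \in F)]|.
Proof.
move=> /subsetP sF.
rewrite (eq_bigr (fun x => \sum_(y | adj G x y && ([set x; y] \in F)) 1)); last first.
  by move=> x _; rewrite sum1_card; apply: eq_card => y; rewrite inE.
rewrite pair_big_dep /=.
rewrite (partition_big (fun p : 'I_n * 'I_n => [set p.1; p.2]) (mem F)) /=; last first.
  by move=> p /andP [].
rewrite mulnC -sum_nat_const; apply: eq_bigr => A AF.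
have := sF A AF; rewrite inE => /existsP [x /existsP [y /andP [xy /eqP eA]]].
have nxy : x != y by apply: contraTneq xy => ->; rewrite adj_irr.
rewrite sum1_card.
have -> : 2 = #|[set (x, y); (y, x)]|.
  by rewrite cards2 xpair_eqE (negPf nxy).
apply: eq_card => -[u v]; rewrite !inE [RHS]unfold_in /= !xpair_eqE.
apply/idP/idP.
  case/orP=> /andP [/eqP -> /eqP ->]; first by rewrite xy -eA AF eqxx.
  by rewrite adj_sym xy setUC -eA AF eqxx.
case/andP=> /andP [uv _] /eqP e; rewrite eA in e.
have nuv : u != v by apply: contraTneq uv => ->; rewrite adj_irr.
have : u \in [set x; y] by rewrite -e set21.
have : v \in [set x; y] by rewrite -e set22.
rewrite !inE => /orP [] /eqP ev /orP [] /eqP eu; subst u v;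
  by rewrite ?eqxx ?orbT // eqxx in nuv *.
Qed.

Lemma card_same G F x :
  #|[set y | same G x y]| =
  #|[set y | same (del_edges G F) x y]|
    + #|[set y | adj G x y && ([set x; y] \in F)]|.
Proof.
rewrite -cardsUI [X in _ + X]eq_card0 ?addn0 => [|y]; last first.
  rewrite !inE /same /= /del_rel.
  by case: eqVneq => [->|_] /=; [rewrite adj_irr | case: adj; case: (_ \in F)].
apply: eq_card => y; rewrite !inE /same /= /del_rel.
by case: (x == y) => //=; case: adj => //=; case: (_ \in F).
Qed.

Lemma sum_card_same G F : F \subset edges G ->
  \sum_x #|[set y | same G x y]| =
  \sum_x #|[set y | same (del_edges G F) x y]| + 2 * #|F|.
Proof.
by move=> sF; rewrite (card_deleted sF) -big_split; apply: eq_bigr => x _;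
  apply: card_same.
Qed.

Definition degree G x := #|[set y | adj G x y]|.
(** In a cluster graph this is the rank of [x] in its clique. *)
Definition lower_degree G (x : 'I_n) := #|[set y | adj G x y && (y < x)]|.

Lemma degreeS G x : (degree G x).+1 = #|[set y | same G x y]|.
Proof.
rewrite (cardsD1 x) inE /same eqxx /= add1n; congr S.
apply: eq_card => y; rewrite !inE eq_sym.
by case: eqVneq => [->|] //=; rewrite adj_irr.
Qed.

(** Within a clique, this number identifies the part of [x] and is also the number of edges from [x]
    to smaller vertices that are lost. Only two counts in the row of [x] enter. *)
Definition place a b G x :=
  start (sizes a b (degree G x).+1) (lower_degree G x).

Lemma place_class a b G C x : cluster_graph G -> C \in classes (same G) -> x \in C ->
  place a b G x = start (sizes a b #|C|) #|[set y in C | y < x]|.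
Proof.
move=> cG hC xC; have eC := class_eq (same_equiv cG) hC xC.
rewrite /place degreeS -eC; congr start; apply: eq_card => y.
rewrite eC !inE /same; case: eqVneq => [->|] //=.
by rewrite adj_irr ltnn.
Qed.

Lemma class_neq0 G C : cluster_graph G -> C \in classes (same G) -> C != set0.
Proof.
move=> cG /imsetP [x _ ->]; apply/set0Pn; exists x.
by rewrite !inE /same eqxx.
Qed.

Lemma sum_same_class G C : cluster_graph G -> C \in classes (same G) ->
  \sum_(x in C) #|[set y | same G x y]| = #|C| * #|C|.
Proof.
move=> cG hC; rewrite -sum_nat_const; apply: eq_bigr => x xC.
by rewrite -(class_eq (same_equiv cG) hC xC).
Qed.

Lemma sum_place_class a b G C : cluster_graph G -> C \in classes (same G) ->
  feasible a b #|C| ->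
  2 * (\sum_(x in C) place a b G x) + sumsq (sizes a b #|C|) = #|C| * #|C|.
Proof.
move=> cG hC fe; rewrite (eq_bigr _ (fun x => @place_class a b G C x cG hC)).
rewrite (sum_rank C (start (sizes a b #|C|))).
have := sum_start (sizes a b #|C|); rewrite sumn_sizes //.
Qed.

Lemma feasible_of_solution a b G F : cluster_graph G ->
  cluster_graph (del_edges G F) -> card_constrained a b (del_edges G F) ->
  forall C, C \in classes (same G) -> feasible a b #|C| /\
  \sum_(x in C) #|[set y | same (del_edges G F) x y]| <= sumsq (sizes a b #|C|).
Proof.
move=> cG cD hD C hC.
apply: (class_refinement (same_equiv cG) (same_equiv cD) _ hC).
- by move=> x y /orP [/eqP ->|/andP [h _]]; rewrite /same ?eqxx // h orbT.
- move=> x _; apply: hD; apply/imsetP; exists x => //.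
  by apply/setP => y; rewrite !inE cluster_connect.
- exact: class_neq0 hC.
Qed.

Lemma solution_lower_bound a b G F : cluster_graph G -> F \subset edges G ->
  cluster_graph (del_edges G F) -> card_constrained a b (del_edges G F) ->
  (forall x, feasible a b (degree G x).+1) /\ \sum_x place a b G x <= #|F|.
Proof.
move=> cG sF cD hD; have eG := same_equiv cG.
have fe := feasible_of_solution cG cD hD.
split=> [x|].
  have hC : [set y | same G x y] \in classes (same G).
    by apply/imsetP; exists x => //; apply/setP => y; rewrite !inE.
  by rewrite degreeS; case: (fe _ hC).
rewrite -(leq_pmul2l (isT : 0 < 2)).
have := sum_card_same sF; rewrite !(sum_classes _ eG).
rewrite (eq_bigr (fun C : {set _} => #|C| * #|C|)) => [|C hC]; last first.
  exact: sum_same_class.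
(* Adding the pairs kept by [F] to both sides makes the right side the sum of the [#|C| * #|C|], and
   the claim splits over the classes. *)
move=> e; rewrite -(leq_add2l (\sum_(C in classes (same G))
  \sum_(x in C) #|[set y | same (del_edges G F) x y]|)) -e.
rewrite big_distrr /= -big_split /=; apply: leq_sum => C hC.
have [feC le] := fe C hC; rewrite -(sum_place_class cG hC feC) addnC.
by rewrite leq_add2l.
Qed.

(** * An optimal deletion set *)

Section Construction.
Variables (a b : nat) (G : sgraph 'I_n).
Hypothesis cG : cluster_graph G.
Hypothesis fe : forall x, feasible a b (degree G x).+1.

Definition cut : {set {set 'I_n}} :=
  [set A | [exists x, exists y, [&& adj G x y, place a b G x != place a b G y
                                 & A == [set x; y]]]].

Lemma cut_sub : cut \subset edges G.
Proof.
apply/subsetP => A; rewrite !inE => /existsP [x /existsP [y /and3P [h _ e]]].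
by apply/existsP; exists x; apply/existsP; exists y; rewrite h.
Qed.

Lemma mem_cut x y : adj G x y ->
  ([set x; y] \in cut) = (place a b G x != place a b G y).
Proof.
move=> xy; rewrite inE; apply/existsP/idP => [[u /existsP [v]]|h]; last first.
  by exists x; apply/existsP; exists y; rewrite xy h /=.
case/and3P=> uv huv /eqP e.
have nuv : u != v by apply: contraTneq uv => ->; rewrite adj_irr.
have : u \in [set x; y] by rewrite e set21.
have : v \in [set x; y] by rewrite e set22.
rewrite !inE => /orP [] /eqP ev /orP [] /eqP eu; subst u v => //.
- by rewrite eqxx in nuv.
- by rewrite eq_sym.
- by rewrite eqxx in nuv.
Qed.

Lemma same_cut x y : same (del_edges G cut) x y =
  same G x y && (place a b G x == place a b G y).
Proof.
rewrite /same /= /del_rel; case: eqVneq => [->|_] /=; first by rewrite eqxx.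
by case xy: (adj G x y) => //=; rewrite mem_cut // negbK.
Qed.

Lemma cut_equiv : equivalence_rel (same (del_edges G cut)).
Proof.
move=> x y z; rewrite !same_cut; have [rxx h] := same_equiv cG x y z.
rewrite rxx eqxx; split=> // /andP [/h -> /eqP ->] //.
Qed.

Lemma feasible_class C : C \in classes (same G) -> feasible a b #|C|.
Proof.
move=> hC; have /set0Pn [x xC] := class_neq0 cG hC.
by rewrite (class_eq (same_equiv cG) hC xC) -degreeS.
Qed.

(** Ranks match the vertices of [C] with positions and the part of [x] with a block. *)
Lemma card_cut_part C x : C \in classes (same G) -> x \in C ->
  #|[set y | same (del_edges G cut) x y]| =
  fiber (sizes a b #|C|) #|[set y in C | y < x]|.
Proof.
move=> hC xC; rewrite /fiber sumn_sizes ?feasible_class //.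
rewrite -(sum_rank C (fun r => nat_of_bool (start (sizes a b #|C|) r ==
    start (sizes a b #|C|) #|[set y in C | y < x]|))).
rewrite -(place_class a b cG hC xC).
rewrite -sum1_card big_mkcond [RHS]big_mkcond; apply: eq_bigr => y _.
rewrite inE same_cut.
have eC : (y \in C) = same G x y.
  by rewrite [in LHS](class_eq (same_equiv cG) hC xC) inE.
rewrite -eC; case: ifP => [/andP [yC /eqP exy]|].
  by rewrite yC -(place_class a b cG hC yC) exy eqxx.
case yC: (y \in C) => //=.
by rewrite -(place_class a b cG hC yC) eq_sym => ->.
Qed.

Lemma rank_lt (C : {set 'I_n}) x : x \in C -> #|[set y in C | y < x]| < #|C|.
Proof.
move=> xC; apply: proper_card; apply/properP; split.
  by apply/subsetP => y; rewrite inE => /andP [].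
by exists x => //; rewrite !inE ltnn andbF.
Qed.

Lemma mem_parts c m e s : a <= b -> c = b - a -> s \in parts a c m e ->
  a <= s <= b.
Proof.
move=> ab ec; elim: m e => //= m IH e; rewrite inE => /orP [/eqP ->|/IH //].
by lia.
Qed.

Lemma card_cut_constrained : card_constrained a b (del_edges G cut).
Proof.
move=> H /imsetP [x _ ->].
have -> : [set y | connect (adj (del_edges G cut)) x y] =
    [set y | same (del_edges G cut) x y].
  by apply/setP => y; rewrite !inE cluster_connect //; apply: equiv_cluster cut_equiv.
pose C := [set y | same G x y].
have hC : C \in classes (same G).
  by apply/imsetP; exists x => //; apply/setP => y; rewrite !inE.
have xC : x \in C by rewrite inE /same eqxx.
have feC := feasible_class hC.
rewrite (card_cut_part hC xC).
have := @fiber_mem (sizes a b #|C|) #|[set y in C | y < x]|.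
rewrite sumn_sizes // => /(_ (rank_lt xC)); apply: mem_parts => //.
(* Feasibility on a nonempty clique forces [a <= b]. *)
by apply: (feasible_le _ feC); rewrite (cardsD1 x) xC.
Qed.

(** The double count of the lower bound becomes an equality, since the parts of a class [C] have the
    sizes [sizes a b #|C|]. *)
Lemma card_cut : #|cut| = \sum_x place a b G x.
Proof.
have eG := same_equiv cG; apply/eqP.
rewrite -(eqn_pmul2l (isT : 0 < 2)); apply/eqP.
have := sum_card_same cut_sub; rewrite !(sum_classes _ eG).
rewrite (eq_bigr (fun C : {set _} => #|C| * #|C|)) => [|C hC]; last first.
  exact: sum_same_class.
move/eqP; rewrite (eq_bigr (fun C : {set 'I_n} => sumsq (sizes a b #|C|) +
    2 * (\sum_(x in C) place a b G x))) => [|C hC]; last first.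
  by rewrite addnC sum_place_class ?feasible_class.
rewrite big_split /= -big_distrr /=.
rewrite [X in _ == X + _](eq_bigr (fun C : {set _} => sumsq (sizes a b #|C|))).
  by rewrite eqn_add2l => /eqP ->.
move=> C hC; rewrite (eq_bigr _ (fun x => @card_cut_part C x hC)).
rewrite (sum_rank C (fiber (sizes a b #|C|))) -sum_fiber.
by rewrite sumn_sizes ?feasible_class.
Qed.

End Construction.

Theorem cluster_deletion_criterion k a b (G : sgraph 'I_n) : cluster_graph G ->
  (exists F : {set {set 'I_n}},
    [/\ F \subset edges G, #|F| <= k, cluster_graph (del_edges G F)
      & card_constrained a b (del_edges G F)]) <->
  (forall x, feasible a b (degree G x).+1) /\ \sum_x place a b G x <= k.
Proof.
move=> cG; split=> [[F [sF cF cD hD]]|[fe le]].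
  have [fe le] := solution_lower_bound cG sF cD hD.
  by split=> //; apply: leq_trans cF.
exists (cut a b G); split; first exact: cut_sub.
- by rewrite card_cut.
- exact/equiv_cluster/cut_equiv.
- exact: card_cut_constrained.
Qed.
End Cluster.

(** * Counter programs and their Turing machines *)

Section Language.
Variable Sigma : finType.

Inductive test := Zero of nat | Letter of Sigma.

Inductive com :=
  | Skip
  | Inc of nat
  | Dec of nat
  | Seq of com & com
  | If of test & com & com
  | Rep of com.

Definition upd (v : nat -> nat) (x a : nat) : nat -> nat :=
  fun y => if y == x then a else v y.

Definition holds (w : seq Sigma) (t : test) (v : nat -> nat) : bool :=
  match t with
  | Zero x => v x == 0
  | Letter a => onth w (v 0) == Some a
  end.

(* Counter 0 is the position on the input word w; all counters saturate at
   the length of w, which is also the number of iterations of Rep. *)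
Fixpoint sem (w : seq Sigma) (c : com) (v : nat -> nat) : nat -> nat :=
  match c with
  | Skip => v
  | Inc x => upd v x (minn (size w) (v x).+1)
  | Dec x => upd v x (v x).-1
  | Seq c d => sem w d (sem w c v)
  | If t c d => if holds w t v then sem w c v else sem w d v
  | Rep c => iter (size w) (sem w c) v
  end.

Definition bounded N (v : nat -> nat) := forall x, v x <= N.

Lemma bounded_upd N v x a : bounded N v -> a <= N -> bounded N (upd v x a).
Proof. by move=> hv ha y; rewrite /upd; case: eqP. Qed.

Lemma bounded_iter N f n v : (forall v, bounded N v -> bounded N (f v)) ->
  bounded N v -> bounded N (iter n f v).
Proof. by move=> hf hv; elim: n => //= n; apply: hf. Qed.

Lemma bounded_sem w c v : bounded (size w) v -> bounded (size w) (sem w c v).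
Proof.
elim: c v => //= [x|x|c IHc d IHd|t c IHc d IHd|c IHc] v hv.
- by apply: bounded_upd; rewrite ?geq_minl.
- by apply: bounded_upd => //; apply: leq_trans (leq_pred _) (hv x).
- exact/IHd/IHc.
- by case: ifP; auto.
- exact: bounded_iter.
Qed.

(** Loops of equal height are never nested in one another, so one tape per height serves as
    iteration counter. *)
Fixpoint height c : nat :=
  match c with
  | Skip | Inc _ | Dec _ => 0
  | Seq c d | If _ c d => maxn (height c) (height d)
  | Rep c => (height c).+1
  end.

(** Counter [0] is not tested for zero: its tape carries the input and has no left end mark. *)
Definition wf_test K (t : test) : bool :=
  if t is Zero x then 0 < x <= K else true.

Fixpoint wf K c : bool :=
  match c with
  | Skip => true
  | Inc x | Dec x => x <= K
  | Seq c d => wf K c && wf K d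
  | If t c d => [&& wf_test K t, wf K c & wf K d]
  | Rep c => wf K c
  end.

(** A loop takes one test per round besides its body, one more test to leave, and at most [N + 1]
    steps to rewind its tape. Both branches of a conditional are charged. *)
Fixpoint cost c : {poly nat} :=
  (match c with
  | Skip | Inc _ | Dec _ => 1
  | Seq c d => cost c + cost d
  | If _ c d => 1 + (cost c + cost d)
  | Rep c => 'X * (1 + cost c) + 1 + ('X + 1)
  end)%R.

Fixpoint time c (N : nat) : nat :=
  match c with
  | Skip | Inc _ | Dec _ => 1
  | Seq c d => time c N + time d N
  | If _ c d => 1 + (time c N + time d N)
  | Rep c => N * (1 + time c N) + 1 + (N + 1)
  end.

Lemma horner_cost c N : ((cost c).[N])%R = time c N.
Proof.
by elim: c => [|x|x|c IHc d IHd|b c IHc d IHd|c IHc] /=;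
  rewrite ?(hornerD, hornerM, hornerX, hornerC) ?IHc ?IHd.
Qed.

(** The extra state of [If] performs the test. The two extra states of [Rep] are the loop test,
    [inl true], and the rewinding of the loop tape, [inl false]. *)
Fixpoint st c : finType :=
  match c with
  | Skip | Inc _ | Dec _ => unit : finType
  | Seq c d => (st c + st d)%type : finType
  | If _ c d => option (st c + st d)%type : finType
  | Rep c => (bool + st c)%type : finType
  end.

Fixpoint entry c : st c :=
  match c with
  | Skip | Inc _ | Dec _ => tt
  | Seq c d => inl (entry c)
  | If _ c d => None
  | Rep c => inl true
  end.

Definition symb := option (Sigma + bool).
Definition lmark : symb := Some (inr true).
Definition rmark : symb := Some (inr false).

Definition only (x : nat) (m : move) : nat -> move :=
  fun i => if i == x then m else Stay.

Definition passes (t : test) (view : nat -> symb) : bool :=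
  match t with
  | Zero x => view x == lmark
  | Letter a => view 0 == Some (inl a)
  end.

(* One control step from the symbols under the heads: the next state (None on
   exit) and the head moves. A loop of height l counts on tape K + 1 + l. *)
Fixpoint ctl (K : nat) (c : com) (view : nat -> symb) :
    st c -> option (st c) * (nat -> move) :=
  match c with
  | Skip => fun _ => (None, fun _ => Stay)
  | Inc x => fun _ =>
      (None, only x (if view x == rmark then Stay else MoveRight))
  | Dec x => fun _ => (None, only x MoveLeft)
  | Seq c d => fun q => match q with
      | inl q => let r := ctl K view q in
          (Some (if r.1 is Some q' then inl q' else inr (entry d)), r.2)
      | inr q => let r := ctl K view q in (omap inr r.1, r.2)
      end
  | If t c d => fun q => match q with
      | None => (Some (Some (if passes t view then inl (entry c)
                             else inr (entry d))), fun _ => Stay)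
      | Some (inl q) => let r := ctl K view q in (omap (Some \o inl) r.1, r.2)
      | Some (inr q) => let r := ctl K view q in (omap (Some \o inr) r.1, r.2)
      end
  | Rep c => fun q => let l := K.+1 + height c in
      match q with
      | inl true =>
          if view l == rmark then (Some (inl false), fun _ => Stay)
          else (Some (inr (entry c)), only l MoveRight)
      | inl false =>
          if view l == lmark then (None, fun _ => Stay)
          else (Some (inl false), only l MoveLeft)
      | inr q => let r := ctl K view q in
          (Some (if r.1 is Some q' then inr q' else inl true), r.2)
      end
  end.

Definition heads_move (mv : nat -> move) (h : nat -> nat) : nat -> nat :=
  fun i => move_head (mv i) (h i).

Lemma heads_only x m h : heads_move (only x m) h = upd h x (move_head m (h x)).
Proof.
apply: functional_extensionality => i; rewrite /heads_move /only /upd.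
by case: eqP => // ->.
Qed.

Lemma upd_id h x : upd h x (h x) = h.
Proof.
by apply: functional_extensionality => i; rewrite /upd; case: eqP => // ->.
Qed.

(** * Simulation of commands by head movements *)

Section Simulation.
Variables (K E : nat) (w : seq Sigma).
Hypothesis w_gt0 : 0 < size w.
Notation N := (size w).

Definition letters (p : nat) : symb := nth None [seq Some (inl a) | a <- w] p.

(** The tapes after setup. As [w] is nonempty, the two end marks of a work tape occupy different
    cells. *)
Definition cells (i p : nat) : symb :=
  if i == 0 then if p == N then rmark else letters p
  else if p == 0 then lmark else if p == N then rmark else None.

Definition scan (h : nat -> nat) (i : nat) : symb :=
  if i <= E then cells i (h i) else None.

Lemma letters_onth p a : (letters p == Some (inl a)) = (onth w p == Some a).
Proof.
rewrite /letters onthE; case: (ltnP p (size w)) => hp.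
  by rewrite !(nth_map a).
by rewrite !nth_default ?size_map.
Qed.

Lemma letters_rmark p : letters p == rmark = false.
Proof.
rewrite /letters; case: (ltnP p (size w)) => hp; last first.
  by rewrite nth_default ?size_map.
by case E0: w hp => [//|a s]; rewrite -E0 => hp; rewrite (nth_map a).
Qed.

Lemma scan_letter h a :
  (scan h 0 == Some (inl a)) = (onth w (h 0) == Some a).
Proof.
rewrite /scan /cells /=; case: (h 0 =P N) => [->|_]; last exact: letters_onth.
by rewrite onthE nth_default ?size_map.
Qed.

Lemma scan_rmark h i : i <= E -> (scan h i == rmark) = (h i == N).
Proof.
move=> hi; rewrite /scan hi /cells; case: (i =P 0) => [->|_].
  by case: (h 0 =P N) => // _; rewrite letters_rmark.
case: (h i =P 0) => [->|_]; last by case: (h i =P N).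
by rewrite [RHS]eq_sym (gtn_eqF w_gt0).
Qed.

Lemma scan_lmark h i : 0 < i <= E -> (scan h i == lmark) = (h i == 0).
Proof.
case/andP=> hi0 hi; rewrite /scan hi /cells (gtn_eqF hi0).
by case: (h i =P 0) => // _; case: (h i =P N).
Qed.

(** Control leaves [c] after exactly [t] steps. Leaving is itself a step, in which the enclosing
    command picks its next state; sequencing therefore costs no extra step. *)
Inductive runs c : st c -> (nat -> nat) -> nat -> (nat -> nat) -> Prop :=
  | RunsExit q h mv : ctl K (scan h) q = (None, mv) ->
      runs q h 1 (heads_move mv h)
  | RunsStep q q' h mv t h' : ctl K (scan h) q = (Some q', mv) ->
      runs q' (heads_move mv h) t h' -> runs q h t.+1 h'.

Lemma runs_seqr c d (q : st d) h t h' :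
  runs q h t h' -> @runs (Seq c d) (inr q) h t h'.
Proof.
elim=> [{}q {}h mv e|{}q q' {}h mv {}t {}h' e _ IH].
  by apply: RunsExit; rewrite /= e.
by apply: RunsStep IH; rewrite /= e.
Qed.

Lemma runs_seq c d (q : st c) h t h1 t' h2 :
  runs q h t h1 -> runs (entry d) h1 t' h2 ->
  @runs (Seq c d) (inl q) h (t + t') h2.
Proof.
elim=> [{}q {}h mv e|{}q q' {}h mv {}t h' e _ IH] hd.
  by apply: RunsStep (runs_seqr c hd); rewrite /= e.
by apply: RunsStep (IH hd); rewrite /= e.
Qed.

Lemma runs_ifl b c d (q : st c) h t h' :
  runs q h t h' -> @runs (If b c d) (Some (inl q)) h t h'.
Proof.
elim=> [{}q {}h mv e|{}q q' {}h mv {}t {}h' e _ IH].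
  by apply: RunsExit; rewrite /= e.
by apply: RunsStep IH; rewrite /= e.
Qed.

Lemma runs_ifr b c d (q : st d) h t h' :
  runs q h t h' -> @runs (If b c d) (Some (inr q)) h t h'.
Proof.
elim=> [{}q {}h mv e|{}q q' {}h mv {}t {}h' e _ IH].
  by apply: RunsExit; rewrite /= e.
by apply: RunsStep IH; rewrite /= e.
Qed.

Lemma runs_body c (q : st c) h t h1 t' h2 :
  runs q h t h1 -> @runs (Rep c) (inl true) h1 t' h2 ->
  @runs (Rep c) (inr q) h (t + t') h2.
Proof.
elim=> [{}q {}h mv e|{}q q' {}h mv {}t h' e _ IH] hd.
  by apply: RunsStep hd; rewrite /= e.
by apply: RunsStep (IH hd); rewrite /= e.
Qed.

(** Head positions: [v] on the counter tapes [0, ..., K], [u] on the loop tapes that follow. *)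
Definition join (v u : nat -> nat) : nat -> nat :=
  fun i => if i <= K then v i else u (i - K.+1).

Lemma join_updl v u x a : x <= K -> join (upd v x a) u = upd (join v u) x a.
Proof.
move=> hx; apply: functional_extensionality => i; rewrite /join /upd.
by case: (i =P x) => [->|_] //; rewrite hx.
Qed.

Lemma join_updr v u l a : join v (upd u l a) = upd (join v u) (K.+1 + l) a.
Proof.
apply: functional_extensionality => i; rewrite /join /upd.
case: leqP => hi; first by rewrite ltn_eqF // addSn ltnS (leq_trans hi) ?leq_addr.
by congr (if _ then _ else _); lia.
Qed.

Lemma joinl v u x : x <= K -> join v u x = v x.
Proof. by rewrite /join => ->. Qed.

Lemma joinr v u l : join v u (K.+1 + l) = u l.
Proof. by rewrite /join addSn ltnNge leq_addr /= -addSn addKn. Qed.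

Lemma upd_upd v x a b : upd (upd v x a) x b = upd v x b.
Proof.
by apply: functional_extensionality => i; rewrite /upd; case: eqP.
Qed.

Lemma upd_eq v x a : upd v x a x = a.
Proof. by rewrite /upd eqxx. Qed.

Lemma runs_rewind c v u j : K.+1 + height c <= E ->
  @runs (Rep c) (inl false) (join v (upd u (height c) j)) j.+1
    (join v (upd u (height c) 0)).
Proof.
move=> hE; elim: j => [|j IH].
  by apply: (@RunsExit (Rep c) _ _ (fun _ => Stay));
    rewrite /= scan_lmark ?hE // joinr upd_eq.
apply: (@RunsStep (Rep c) _ (inl false) _ (only (K.+1 + height c) MoveLeft)).
  by rewrite /= scan_lmark ?hE // joinr upd_eq.
by rewrite heads_only !joinr -join_updr upd_eq upd_upd.
Qed.

Lemma holds_join b v u : wf_test K b -> K <= E ->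
  passes b (scan (join v u)) = holds w b v.
Proof.
case: b => [x|a] /= => [/andP [x0 hx] hK|_ _]; last first.
  by rewrite scan_letter joinl.
by rewrite scan_lmark ?joinl // x0 (leq_trans hx).
Qed.

(** Structural induction. The loop tapes used by [c] start at [0] and are returned to [0], so that
    an enclosing loop can run [c] again. *)
Lemma runs_sem c v u : wf K c -> K + height c <= E ->
  bounded N v -> (forall l, l < height c -> u l = 0) ->
  exists t, t <= time c N /\
    runs (entry c) (join v u) t (join (sem w c v) u).
Proof.
elim: c v u => [|x|x|c IHc d IHd|b c IHc d IHd|c IHc] v u /=.
- move=> _ _ _ _; exists 1; split=> //.
  exact: (@RunsExit Skip _ _ (fun _ => Stay)).
- move=> hx; rewrite addn0 => hK hv _; exists 1; split=> //.
  rewrite join_updl //.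
  have -> : minn N (v x).+1 =
      move_head (if scan (join v u) x == rmark then Stay else MoveRight)
        (join v u x).
    rewrite scan_rmark ?(leq_trans hx) // joinl //.
    by have := hv x; case: eqP => /= h1 h2; lia.
  by rewrite -heads_only; apply: RunsExit.
- move=> hx _ _ _; exists 1; split=> //.
  rewrite join_updl // -[_.-1]/(move_head MoveLeft (v x)) -(joinl v u hx).
  by rewrite -heads_only; apply: RunsExit.
- case/andP=> hc hd hE hv hu.
  have [||||t1 [le1 r1]] := IHc v u => //; first by lia.
    by move=> l hl; apply: hu; lia.
  have [||||t2 [le2 r2]] := IHd (sem w c v) u => //; first by lia.
  + exact: bounded_sem.
  + by move=> l hl; apply: hu; lia.
  by exists (t1 + t2); split; [rewrite leq_add | apply: runs_seq r1 r2].
- case/and3P=> hb hc hd hE hv hu.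
  have hK : K <= E by lia.
  have [||||t1 [le1 r1]] := IHc v u => //; first by lia.
    by move=> l hl; apply: hu; lia.
  have [||||t2 [le2 r2]] := IHd v u => //; first by lia.
    by move=> l hl; apply: hu; lia.
  case: ifP => hold.
  + exists t1.+1; split; first by lia.
    apply: (@RunsStep (If b c d) None _ _ (fun _ => Stay)) (runs_ifl b d r1).
    by rewrite /= holds_join // hold.
  + exists t2.+1; split; first by lia.
    apply: (@RunsStep (If b c d) None _ _ (fun _ => Stay)) (runs_ifr b c r2).
    by rewrite /= holds_join // hold.
- move=> hc hE hv hu; set l := height c.
  have hu0 : upd u l 0 = u by rewrite -(hu l) // upd_id.
  (* Here [j] rounds remain and the head of the loop tape stands at [N - j]. *)
  suff loop j : j <= N -> exists t, t <= j * (1 + time c N) + 1 + (N + 1) /\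
      @runs (Rep c) (inl true) (join (iter (N - j) (sem w c) v) (upd u l (N - j)))
        t (join (iter N (sem w c) v) u).
    have [t [le_t r]] := loop N (leqnn _).
    by exists t; split=> //; move: r; rewrite subnn /= hu0.
  elim: j => [|j IHj] hj.
    exists N.+2; split; first by lia.
    rewrite subn0; apply: (@RunsStep (Rep c) _ (inl false) _ (fun _ => Stay)).
      by rewrite /= scan_rmark ?joinr ?upd_eq ?eqxx //; lia.
    by rewrite -{2}hu0; apply: runs_rewind; lia.
  have [t [le_t r]] := IHj (ltnW hj).
  set v' := iter (N - j.+1) (sem w c) v.
  have eNj : N - j = (N - j.+1).+1 by lia.
  have [|||| t1 [le1 r1]] := IHc v' (upd u l (N - j)) => //; first by lia.
  + by apply: bounded_iter => // v0; apply: bounded_sem.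
  + by move=> i hi; rewrite /upd ltn_eqF //; apply: hu; rewrite ltnW.
  exists (t1 + t).+1; split; first by lia.
  apply: (@RunsStep (Rep c) _ (inr (entry c)) _ (only (K.+1 + l) MoveRight)).
    by rewrite /= scan_rmark ?joinr ?upd_eq ?ifF //; lia.
  rewrite heads_only joinr upd_eq /= -join_updr upd_upd -eNj.
  apply: runs_body r1 _.
  by move: r; rewrite {1}eNj iterS.
Qed.

End Simulation.

(** * The complete Turing machine *)

Section Machine.
Variables (K : nat) (c : com) (out : nat).
Let E := K + height c.

Definition mstate : finType := (option bool + (st c + option bool))%type.
Definition main (q : st c) : mstate := inr (inl q).
Definition mark0 : mstate := inl None.
Definition measure : mstate := inl (Some true).
Definition rewind : mstate := inl (Some false).
Definition check : mstate := inr (inr None).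
Definition halt b : mstate := inr (inr (Some b)).

Definition view (f : {ffun 'I_E.+1 -> option (Sigma + bool)}) (i : nat) : symb :=
  if i <= E then f (inord i) else None.

Definition mtrans (q : mstate) (f : {ffun 'I_E.+1 -> option (Sigma + bool)}) :
    mstate * ('I_E.+1 -> option (Sigma + bool) * move) :=
  match q with
  | inl None =>
      (measure, fun i => (if i == ord0 then f i else lmark, MoveRight))
  | inl (Some true) =>
      if view f 0 == None then (rewind, fun i => (rmark, Stay))
      else (measure, fun i => (f i, MoveRight))
  | inl (Some false) =>
      if view f 1 == lmark then (main (entry c), fun i => (f i, Stay))
      else (rewind, fun i => (f i, MoveLeft))
  | inr (inl q) => let r := ctl K (view f) q in
      (if r.1 is Some q' then main q' else check, fun i => (f i, r.2 i))
  | inr (inr None) => (halt (view f out == lmark), fun i => (f i, Stay))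
  | inr (inr (Some b)) => (q, fun i => (f i, Stay))
  end.

(* Three setup phases mark cell 0 of the work tapes, mark cell [size w] of all
   tapes while scanning the input, and bring the heads back. *)
Definition machine : tm Sigma :=
  @TM Sigma E mstate bool mark0
    (fun q => if q is inr (inr (Some b)) then Some b else None) mtrans.

Section Run.
Variable w : seq Sigma.
Hypothesis w_gt0 : 0 < size w.
Hypothesis K_gt0 : 0 < K.
Notation N := (size w).

(** After setup no cell changes any more, so a configuration is a state with head positions. *)
Definition conf (q : mstate) (h : nat -> nat) : config machine :=
  @Config _ machine q (fun i => @Tape _ machine (cells w i) (h i)).

Lemma act_id (t : tape machine) m :
  act t (content t (head_pos t), m) = Tape (content t) (move_head m (head_pos t)).
Proof.
rewrite /act /=; congr Tape.
by apply: functional_extensionality => p; case: eqP => // ->.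
Qed.

Lemma view_conf (h : nat -> nat) :
  view [ffun i : 'I_E.+1 => cells w i (h i)] = scan E w h.
Proof.
apply: functional_extensionality => i; rewrite /view /scan.
by case: leqP => // hi; rewrite ffunE /= inordK.
Qed.

Lemma conf_moves q (h : nat -> nat) (mv : nat -> move) :
  @Config _ machine q (fun i : 'I_E.+1 =>
     act (@Tape _ machine (cells w i) (h i))
       ([ffun j : 'I_E.+1 => cells w j (h j)] i, mv i))
  = conf q (heads_move mv h).
Proof.
congr Config; apply: functional_extensionality => i.
by rewrite ffunE; apply: act_id.
Qed.

Lemma runs_machine (q : st c) h t h' : runs K E w q h t h' ->
  iter t (@step _ machine) (conf (main q) h) = conf check h'.
Proof.
elim=> [{}q {}h mv e|{}q q' {}h mv {}t {}h' e _ IH].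
  by rewrite /= /step /= view_conf -conf_moves e.
by rewrite iterSr -IH /step /= view_conf -conf_moves e.
Qed.

Lemma check_machine h : 0 < out <= K ->
  @step _ machine (conf check h) = conf (halt (h out == 0)) h.
Proof.
move=> /andP [o0 oK]; rewrite /step /= view_conf scan_lmark //; last first.
  by rewrite o0 (leq_trans oK) ?leq_addr.
exact: (conf_moves (halt (h out == 0)) h (fun _ => Stay)).
Qed.

(* [cells] before the right end marks are written. *)
Definition partial_cells (i p : nat) : symb :=
  if i == 0 then letters w p else if p == 0 then lmark else None.

Definition pconf (q : mstate) (p : nat) : config machine :=
  @Config _ machine q (fun i => @Tape _ machine (partial_cells i) p).

Lemma step_mark0 : @step _ machine (init machine w) = pconf measure 1.
Proof.
rewrite /step /=; congr Config; apply: functional_extensionality => i.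
rewrite /act /=; congr Tape.
apply: functional_extensionality => p; rewrite /partial_cells ffunE.
by case: (i =P ord0) => [->|/eqP hi] /=; [|rewrite -val_eqE /= in hi; rewrite (negPf hi)];
  case: eqP => // ->.
Qed.

Lemma letters_none p : (letters w p == None) = (N <= p).
Proof.
rewrite /letters; case: leqP => hp; first by rewrite nth_default ?size_map.
by case E0: w hp => [//|a s]; rewrite -E0 => hp; rewrite (nth_map a).
Qed.

Lemma step_measure p : 0 < p < N ->
  @step _ machine (pconf measure p) = pconf measure p.+1.
Proof.
case/andP=> p0 hp; rewrite /step /= /view ffunE /= inordK // letters_none leqNgt hp /=.
congr Config; apply: functional_extensionality => i.
by rewrite ffunE act_id.
Qed.

Lemma step_mark_end :
  @step _ machine (pconf measure N) = conf rewind (fun _ => N).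
Proof.
rewrite /step /= /view ffunE /= inordK // letters_none leqnn /=.
congr Config; apply: functional_extensionality => i.
rewrite /act /=; congr Tape; apply: functional_extensionality => p.
rewrite /partial_cells /cells; case: (p =P N) => [->|] //.
by case: (val i == 0) => //; rewrite gtn_eqF.
Qed.

(** All heads move together, so the left mark of tape [1] announces the arrival of every head, that
    of the unmarked tape [0] included. *)
Lemma iter_rewind p :
  iter p.+1 (@step _ machine) (conf rewind (fun _ => p))
  = conf (main (entry c)) (fun _ => 0).
Proof.
have one : 0 < 1 <= E by rewrite /= (leq_trans K_gt0) ?leq_addr.
elim: p => [|p IH].
  rewrite /= /step /= (view_conf (fun _ => 0)) scan_lmark //=.
  exact: (conf_moves _ _ (fun _ => Stay)).
rewrite iterSr -IH; congr iter.
rewrite /step /= (view_conf (fun _ => p.+1)) scan_lmark //=.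
exact: (conf_moves rewind (fun _ => p.+1) (fun _ => MoveLeft)).
Qed.

(** [N] steps bring the heads to cell [N], one writes the right marks, and [N + 1] rewind. *)
Lemma iter_setup :
  iter (N + N.+2) (@step _ machine) (init machine w)
  = conf (main (entry c)) (fun _ => 0).
Proof.
have meas p : p < N -> iter p.+1 (@step _ machine) (init machine w) =
    pconf measure p.+1.
  elim: p => [_|p IH hp]; first exact: step_mark0.
  rewrite iterS (IH (ltnW hp)); exact: step_measure.
have eN : N = N.-1.+1 by rewrite prednK.
have lN : N.-1 < N by rewrite -eN.
rewrite addnC iterD [X in iter X _ (init _ _)]eN (meas _ lN) -eN.
rewrite iterSr step_mark_end; exact: iter_rewind.
Qed.

Lemma iter_halt t b h :
  iter t (@step _ machine) (conf (halt b) h) = conf (halt b) h.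
Proof. by elim: t => [|t IH]; rewrite ?iterS ?IH. Qed.

Lemma machine_answers T : wf K c -> 0 < out <= K ->
  N + N.+2 + time c N + 1 <= T ->
  answers_within machine w T (sem w c (fun _ => 0) out == 0).
Proof.
move=> hwf ho hT.
have [t [le_t r]] := @runs_sem K E w w_gt0 c (fun _ => 0) (fun _ => 0) hwf
  (leqnn _) (fun _ => leq0n _) (fun _ _ => erefl).
rewrite /answers_within.
(* From right to left: setup, program, final check, idling in the halting state. *)
have -> : T = (T - (N + N.+2 + t + 1)) + (1 + (t + (N + N.+2))) by lia.
rewrite iterD (iterD 1) (iterD t) iter_setup.
have {1}-> : (fun _ => 0) = join K (fun _ => 0) (fun _ => 0).
  by apply: functional_extensionality => i; rewrite /join; case: ifP.
rewrite (runs_machine r) [iter 1 _ _]check_machine // iter_halt /= joinl //.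
by case/andP: ho.
Qed.

End Run.
End Machine.

Theorem poly_time_of_com (Inst : Type) (enc : Inst -> seq Sigma)
    (yes C : Inst -> Prop) (K : nat) (c : com) (out : nat) :
  wf K c -> 0 < out <= K ->
  (forall I, C I -> 0 < size (enc I)) ->
  (forall I, C I -> (sem (enc I) c (fun _ => 0) out == 0 <-> yes I)) ->
  poly_time_solvable_on enc yes C.
Proof.
move=> hwf ho enc_gt0 correct.
exists (machine K c out), ('X + ('X + 1 + 1) + cost c + 1)%R => I CI.
exists (sem (enc I) c (fun _ => 0) out == 0); split; last exact: correct.
apply: machine_answers => //; first exact: enc_gt0.
  by case/andP: ho; apply: leq_trans.
rewrite !hornerD hornerX hornerC horner_cost.
by rewrite -[X in _ <= X]/(size (enc I) + (size (enc I) + 1 + 1) +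
  time c (size (enc I)) + 1); lia.
Qed.

End Language.

(** * Derived commands: bounded loops, addition, subtraction, clearing *)

Section Macros.
Variables (Sigma : finType) (w : seq Sigma).
Notation N := (size w).
Implicit Types (v : nat -> nat) (c d : com Sigma).

Definition fresh_test (x : nat) (b : test Sigma) : bool :=
  if b is Zero y then x != y else x != 0.

Fixpoint fresh (x : nat) c : bool :=
  match c with
  | Skip => true
  | Inc y | Dec y => x != y
  | Seq c d => fresh x c && fresh x d
  | If b c d => [&& fresh_test x b, fresh x c & fresh x d]
  | Rep c => fresh x c
  end.

Lemma upd_comm v x y a b : x != y -> upd (upd v x a) y b = upd (upd v y b) x a.
Proof.
move=> hxy; apply: functional_extensionality => i; rewrite /upd.
by case: (i =P y) => // ->; rewrite eq_sym (negPf hxy).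
Qed.

Lemma upd_neq v x a y : y != x -> upd v x a y = v y.
Proof. by rewrite /upd => /negPf ->. Qed.

(** A counter that [c] neither reads nor writes commutes with it; a letter test reads counter
    [0]. *)
Lemma sem_fresh x c v a : fresh x c -> sem w c (upd v x a) = upd (sem w c v) x a.
Proof.
elim: c v => //= [y|y|c IHc d IHd|b c IHc d IHd|c IHc] v.
- by move=> hxy; rewrite upd_comm // upd_neq // eq_sym.
- by move=> hxy; rewrite upd_comm // upd_neq // eq_sym.
- by case/andP=> hc hd; rewrite IHc // IHd.
- case/and3P=> hb hc hd; rewrite IHc // IHd //.
  suff -> : holds w b (upd v x a) = holds w b v by case: ifP.
  by case: b hb => [y|l] /= h; rewrite upd_neq // eq_sym.
- by move=> hc; elim: {1 2}N => //= n ->; rewrite IHc.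
Qed.

Lemma sem_fresh_val x c v : fresh x c -> sem w c v x = v x.
Proof. by move=> hx; rewrite -[v in LHS](upd_id v x) sem_fresh // upd_eq. Qed.

Lemma iter_fresh x c v n : fresh x c -> iter n (sem w c) v x = v x.
Proof. by move=> hx; elim: n => //= n <-; apply: sem_fresh_val. Qed.

(* Locked, so that rewriting with [sem_seq] does not open it. *)
Definition For (x z : nat) c : com Sigma := locked
  (Seq (Rep (If (Zero _ x) (Skip _) (Seq (Dec _ x) (Seq (Inc _ z) c))))
       (Rep (If (Zero _ z) (Skip _) (Seq (Dec _ z) (Inc _ x))))).

(** The first loop moves [x] to [z] unit by unit, running [c] each time; the second moves it back.
    As [v x <= N], the [N] rounds suffice, and surplus rounds do nothing. *)
Lemma sem_for x z c v : bounded N v -> x != z -> fresh x c -> fresh z c ->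
  v z = 0 -> sem w (For x z c) v = iter (v x) (sem w c) v.
Proof.
move=> hv hxz hx hz vz0; rewrite /For -lock /=.
set f1 := fun u => if u x == 0 then _ else _.
set f2 := fun u => if u z == 0 then _ else _.
have it1 j : iter j f1 v =
    upd (upd (iter (minn j (v x)) (sem w c) v) x (v x - j)) z (minn j (v x)).
  elim: j => [|j IH] /=.
    by rewrite min0n /= subn0 upd_id -[X in upd _ _ X]vz0 upd_id.
  rewrite IH {1}/f1 upd_neq // upd_eq.
  case: ifP => /eqP h; first by congr (upd (upd (iter _ _ _) _ _) _ _); lia.
  have -> : minn j.+1 (v x) = (minn j (v x)).+1 by lia.
  rewrite (@upd_neq _ x _ z) 1?eq_sym // upd_eq (@upd_comm _ z) 1?eq_sym //.
  rewrite !upd_upd.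
  rewrite sem_fresh // sem_fresh // iterS.
  by congr (upd (upd _ _ _) _ _); have := hv x; lia.
rewrite it1; have -> : minn N (v x) = v x by have := hv x; lia.
have -> : v x - N = 0 by have := hv x; lia.
set F := iter (v x) _ v.
have Fx : F x = v x by apply: iter_fresh.
have Fz : F z = 0 by rewrite -vz0; apply: iter_fresh.
have it2 j : iter j f2 (upd (upd F x 0) z (v x)) =
    upd (upd F x (minn j (v x))) z (v x - j).
  elim: j => [|j IH] /=; first by rewrite min0n subn0.
  rewrite IH {1}/f2 upd_eq.
  case: ifP => /eqP h; first by congr (upd (upd _ _ _) _ _); lia.
  rewrite upd_upd upd_neq // upd_eq (@upd_comm _ z) 1?eq_sym // upd_upd.
  by congr (upd (upd _ _ _) _ _); have := hv x; lia.
rewrite it2.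
have -> : minn N (v x) = F x by have := hv x; lia.
have -> : v x - N = F z by have := hv x; lia.
by rewrite upd_id upd_id.
Qed.

Lemma iter_inc n y v : bounded N v ->
  iter n (sem w (Inc _ y)) v = upd v y (minn N (v y + n)).
Proof.
move=> hv; have := hv y => hy; elim: n => [|n IH] /=.
  by rewrite addn0 (minn_idPr hy) upd_id.
by rewrite IH /= upd_eq upd_upd; congr upd; lia.
Qed.

Lemma iter_dec n y v : iter n (sem w (Dec _ y)) v = upd v y (v y - n).
Proof.
elim: n => [|n IH] /=; first by rewrite subn0 upd_id.
by rewrite IH /= upd_eq upd_upd; congr upd; lia.
Qed.

Definition AddTo x y z := For x z (Inc _ y).
Definition SubFrom x y z := For x z (Dec _ y).
Definition Clear x : com Sigma := Rep (Dec _ x).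

Lemma sem_add x y z v : bounded N v -> uniq [:: x; y; z] -> v z = 0 ->
  sem w (AddTo x y z) v = upd v y (minn N (v y + v x)).
Proof.
rewrite [uniq _]/= !inE !negb_or => hv /and3P [/andP [hxy hxz] hyz _] vz0.
by rewrite /AddTo sem_for ?iter_inc //= eq_sym.
Qed.

Lemma sem_sub x y z v : bounded N v -> uniq [:: x; y; z] -> v z = 0 ->
  sem w (SubFrom x y z) v = upd v y (v y - v x).
Proof.
rewrite [uniq _]/= !inE !negb_or => hv /and3P [/andP [hxy hxz] hyz _] vz0.
by rewrite /SubFrom sem_for ?iter_dec //= eq_sym.
Qed.

Lemma sem_clear x v : bounded N v -> sem w (Clear x) v = upd v x 0.
Proof. by move=> hv; rewrite /= iter_dec; congr upd; have := hv x; lia. Qed.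

Lemma sem_seq c d v : sem w (Seq c d) v = sem w d (sem w c v).
Proof. by []. Qed.

Lemma sem_inc x v : sem w (Inc _ x) v = upd v x (minn N (v x).+1).
Proof. by []. Qed.

Lemma sem_dec x v : sem w (Dec _ x) v = upd v x (v x).-1.
Proof. by []. Qed.

Lemma sem_if b c d v :
  sem w (If b c d) v = if holds w b v then sem w c v else sem w d v.
Proof. by []. Qed.

Lemma sem_rep c v : sem w (Rep c) v = iter N (sem w c) v.
Proof. by []. Qed.

(** Counters are held in a list, so that reading and writing them reduces by computation. *)
Lemma upd_nth s x a : upd (nth 0 s) x a = nth 0 (set_nth 0 s x a).
Proof.
by apply: functional_extensionality => i; rewrite nth_set_nth /= /upd.
Qed.

Lemma bounded_nth s : all (leq^~ N) s -> bounded N (nth 0 s).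
Proof.
move=> hs x; case: (ltnP x (size s)) => hx; last by rewrite nth_default.
by apply: (allP hs); apply: mem_nth.
Qed.

Lemma inc_nth s x :
  sem w (Inc _ x) (nth 0 s) = nth 0 (set_nth 0 s x (minn N (nth 0 s x).+1)).
Proof. by rewrite sem_inc upd_nth. Qed.

Lemma dec_nth s x :
  sem w (Dec _ x) (nth 0 s) = nth 0 (set_nth 0 s x (nth 0 s x).-1).
Proof. by rewrite sem_dec upd_nth. Qed.

Lemma add_nth s x y z : all (leq^~ N) s -> uniq [:: x; y; z] -> nth 0 s z = 0 ->
  sem w (AddTo x y z) (nth 0 s) =
  nth 0 (set_nth 0 s y (minn N (nth 0 s y + nth 0 s x))).
Proof. by move=> hs *; rewrite sem_add ?upd_nth //; apply: bounded_nth. Qed.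

Lemma sub_nth s x y z : all (leq^~ N) s -> uniq [:: x; y; z] -> nth 0 s z = 0 ->
  sem w (SubFrom x y z) (nth 0 s) =
  nth 0 (set_nth 0 s y (nth 0 s y - nth 0 s x)).
Proof. by move=> hs *; rewrite sem_sub ?upd_nth //; apply: bounded_nth. Qed.

Lemma clear_nth s x : nth 0 s x <= N ->
  sem w (Clear x) (nth 0 s) = nth 0 (set_nth 0 s x 0).
Proof. by move=> hx; rewrite /= iter_dec upd_nth -subn_eq0 in hx *; rewrite (eqP hx). Qed.

End Macros.
Arguments sem : simpl never.

(** * The program *)

Section Program.
Variables (Sigma : finType) (bit : bool -> Sigma) (stop : Sigma).
Hypotheses (bit_inj : injective bit) (bit_stop : forall b, bit b != stop).

Notation skip := (Skip Sigma).
Notation inc := (Inc Sigma).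
Notation dec := (Dec Sigma).
Notation "c ;; d" := (Seq c d) (at level 61, right associativity).
Notation ifz x := (If (Zero Sigma x)).
Notation ifl b := (If (Letter (bit b))).

(* vK, vA, vB hold the saturated budget and size bounds and vC the difference
   B - A; vD counts deleted edges; vi is the current row, vn the size of its
   clique, vr the rank of vi in the clique, less the sizes of the parts already
   passed; ve is the excess n - m A still to be distributed over the parts. *)
Notation vpos := 0.
Notation vK := 1.
Notation vA := 2.
Notation vB := 3.
Notation vC := 4.
Notation vD := 5.
Notation vbad := 6.
Notation vi := 7.
Notation vj := 8.
Notation vn := 9.
Notation vr := 10.
Notation vt := 11.
Notation ve := 12.
Notation vs := 13.
Notation vu := 14.
Notation vdone := 15.
Notation vz := 16.

Notation addc x y := (@AddTo Sigma x y vz).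
Notation subc x y := (@SubFrom Sigma x y vz).
Notation clearc x := (@Clear Sigma x).

Definition double x := addc x vt ;; addc vt x ;; clearc vt.

(* The weight of the current bit is kept in vn. *)
Definition decode_step x :=
  ifl true (addc vn x ;; double vn ;; inc vpos)
    (ifl false (double vn ;; inc vpos) skip).

(** Bits come least significant first, so the weight starts at [1] and doubles. At the separator the
    remaining rounds do nothing; the last command steps over it. *)
Definition decode x :=
  inc vn ;; Rep (decode_step x) ;; clearc vn ;; inc vpos.

(** [vj] counts down from the row index; the ones met before it reaches [0] lie left of the diagonal
    and are counted in [vr]. *)
Definition read_step :=
  ifl true (inc vn ;; ifz vj skip (inc vr) ;; dec vj ;; inc vpos)
    (ifl false (dec vj ;; inc vpos) skip).

(** Each round reserves one part: [vt] loses [B] until it is exhausted, and [ve] loses [A], every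
    missing unit being recorded in [vbad]. *)
Definition split_step :=
  ifz vt skip (subc vB vt ;; For vA vz (ifz ve (inc vbad) (dec ve))).

(** One unfolding of [start (parts A C m e) r]: [vs] is the size of the next part, and [vu] is zero
    exactly when the vertex lies beyond that part. *)
Definition locate_step :=
  ifz vdone
    (addc vA vs ;; For vC vz (ifz ve skip (dec ve ;; inc vs)) ;;
     addc vs vu ;; subc vr vu ;;
     ifz vu (subc vs vr ;; addc vs vD) (inc vdone) ;;
     clearc vu ;; clearc vs)
    skip.

Definition row_step :=
  addc vi vj ;; inc vn ;; Rep read_step ;; inc vpos ;; clearc vj ;;
  addc vn vt ;; addc vn ve ;; Rep split_step ;;
  ifz vt skip (inc vbad) ;; clearc vt ;;
  Rep locate_step ;;
  clearc vn ;; clearc vr ;; clearc ve ;; clearc vdone ;; inc vi.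

(** The answer is yes when [vbad] ends at [0]; the last two commands add to it the amount by which
    the deletions exceed the budget. *)
Definition prog :=
  decode vK ;; decode vA ;; decode vB ;; addc vB vC ;; subc vA vC ;;
  Rep (ifl true row_step (ifl false row_step skip)) ;;
  subc vK vD ;; addc vD vbad.

Lemma wf_prog : wf 16 prog.
Proof.
rewrite /prog /row_step /locate_step /split_step /decode /decode_step /double.
by rewrite /AddTo /SubFrom /For -!lock.
Qed.

Definition delim (s : seq bool) : seq Sigma := rcons (map bit s) stop.

Fixpoint bval (s : seq bool) : nat :=
  if s is b :: s' then b + (bval s').*2 else 0.

Lemma stop_bit b : (Some stop == Some (bit b)) = false.
Proof. by apply/negbTE; rewrite eq_sym; apply: bit_stop. Qed.

(** * Correctness of the program on a fixed word *)

Section Word.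
Variable w : seq Sigma.
Notation N := (size w).

Lemma sem_double x v : bounded N v -> uniq [:: x; vt; vz] ->
  v vt = 0 -> v vz = 0 ->
  sem w (double x) v = upd v x (minn N (v x).*2).
Proof.
move=> hv hu vt0 vz0; rewrite /double !sem_seq.
have hx := hv x.
have [xt xz] : x != vt /\ x != vz by move: hu; rewrite /= !inE; case: eqP; case: eqP.
have hu' : uniq [:: vt; x; vz] by rewrite /= !inE negb_or eq_sym xt xz.
rewrite (@sem_add _ w x) // vt0 add0n (minn_idPr hx).
rewrite sem_add ?upd_eq ?upd_neq //; last by apply: bounded_upd.
rewrite sem_clear; last by apply: bounded_upd; [apply: bounded_upd|rewrite geq_minl].
rewrite addnn; apply: functional_extensionality => y; rewrite /upd.
by case: (y =P vt) => // ->; rewrite eq_sym (negPf xt) vt0.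
Qed.

Lemma onth_mid (pre post : seq Sigma) a : onth (pre ++ a :: post) (size pre) = Some a.
Proof. by rewrite onthE map_cat nth_cat size_map ltnn subnn. Qed.

Lemma decode_step_bit x (b : bool) v pre post :
  w = pre ++ bit b :: post -> bounded N v ->
  x != 0 -> x != vn -> x != vt -> x != vz -> v vt = 0 -> v vz = 0 ->
  v 0 = size pre ->
  sem w (decode_step x) v =
  upd (upd (upd v x (minn N (v x + b * v vn))) vn (minn N (v vn).*2))
    0 (size pre).+1.
Proof.
move=> ew hv x0 xn xt xz vt0 vz0 e0.
have hN : minn N (size pre).+1 = (size pre).+1.
  by apply/minn_idPr; rewrite ew size_cat /= addnS ltnS leq_addr.
have hl b' : holds w (Letter (bit b')) v = (b == b').
  by rewrite /= e0 [in LHS]ew onth_mid -(inj_eq bit_inj).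
have hu : uniq [:: vn; x; vz] by rewrite /= !inE negb_or eq_sym xn xz.
have hv1 : bounded N (upd v x (minn N (v x + v vn))).
  by apply: bounded_upd; rewrite ?geq_minl.
have [tx zx nx ox] : [/\ vt != x, vz != x, vn != x & 0 != x].
  by rewrite ![_ == x]eq_sym xt xz xn x0.
rewrite /decode_step !sem_if !hl; case: b {ew hl}; first rewrite eqxx.
  rewrite 2!sem_seq sem_add // sem_double ?upd_neq // sem_inc upd_neq //.
  by rewrite upd_neq // e0 hN mul1n.
rewrite -[LHS]/(sem w (double vn ;; inc vpos) v) sem_seq sem_double // sem_inc.
rewrite upd_neq // e0 hN mul0n addn0.
by rewrite (minn_idPr (hv x)) upd_id.
Qed.

Lemma step_stop x v pre post :
  w = pre ++ stop :: post -> v 0 = size pre -> sem w (decode_step x) v = v.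
Proof.
move=> ew e0; rewrite /decode_step !sem_if /= e0 [in onth _]ew onth_mid.
by rewrite !stop_bit.
Qed.

Lemma decode_loop x (s : seq bool) v pre post m :
  w = pre ++ delim s ++ post -> bounded N v ->
  x != 0 -> x != vn -> x != vt -> x != vz -> v vt = 0 -> v vz = 0 ->
  v 0 = size pre -> size s <= m ->
  exists p, iter m (sem w (decode_step x)) v =
  upd (upd (upd v x (minn N (v x + v vn * bval s))) vn p) 0 (size pre + size s).
Proof.
move=> + + x0 xn xt xz.
have [tx zx nx ox] : [/\ vt != x, vz != x, vn != x & 0 != x].
  by rewrite ![_ == x]eq_sym xt xz xn x0.
elim: s v pre m => [|b s IH] v pre m ew hv vt0 vz0 e0 hm /=.
  exists (v vn); rewrite iter_fix; last exact: step_stop ew e0.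
  by rewrite muln0 !addn0 (minn_idPr (hv x)) -e0 !upd_id.
case: m hm => // m hm; rewrite iterSr.
rewrite (@decode_step_bit x b v pre (delim s ++ post)) //.
set v' := upd _ 0 _.
have hv' : bounded N v'.
  apply: bounded_upd; last by rewrite ew size_cat /= addnS ltnS leq_addr.
  apply: bounded_upd; last exact: geq_minl.
  by apply: bounded_upd; rewrite ?geq_minl.
have [|||||p ->] := IH v' (rcons pre (bit b)) m _ hv' => //.
- by rewrite cat_rcons.
- by rewrite /v' !upd_neq.
- by rewrite /v' !upd_neq.
- by rewrite /v' upd_eq size_rcons.
exists p; rewrite size_rcons addSnnS.
have -> : v' x = minn N (v x + b * v vn) by rewrite /v' 2?upd_neq // upd_eq.
have -> : v' vn = minn N (v vn).*2 by rewrite /v' upd_neq // upd_eq.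
(* Saturating the weight is harmless: if the doubled weight exceeds [N], either the remaining bits
   are all zero or both sides equal [N]. *)
have -> : minn N (minn N (v x + b * v vn) + minn N (v vn).*2 * bval s) =
    minn N (v x + v vn * (b + (bval s).*2)).
  case: (leqP (v vn).*2 N) => h.
    by rewrite -!muln2; case: b {ew v' hv' hm}; nia.
  rewrite -!muln2; move: h; rewrite -muln2 => h.
  by case: b {ew v' hv' hm}; case: (bval s) => [|k]; nia.
apply: functional_extensionality => y; rewrite /v' /upd.
by do 4!case: eqP => // _.
Qed.

Lemma sem_decode x (s : seq bool) v pre post :
  w = pre ++ delim s ++ post -> bounded N v ->
  x != 0 -> x != vn -> x != vt -> x != vz -> v vt = 0 -> v vz = 0 ->
  v vn = 0 -> v x = 0 -> v 0 = size pre ->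
  sem w (decode x) v =
  upd (upd v x (minn N (bval s))) 0 (size pre + (size s).+1).
Proof.
move=> ew hv x0 xn xt xz vt0 vz0 vn0 vx0 e0.
rewrite /decode !sem_seq (sem_rep _ (decode_step x)).
have [tx zx nx ox] : [/\ vt != x, vz != x, vn != x & 0 != x].
  by rewrite ![_ == x]eq_sym xt xz xn x0.
have szw : N = size pre + (size s).+1 + size post.
  by rewrite ew !size_cat size_rcons size_map addnA.
set v1 := sem w (inc vn) v.
have hv1 : bounded N v1 by apply: bounded_sem.
have e1 : v1 vn = 1 by rewrite /v1 sem_inc upd_eq vn0; lia.
have v1N y : y != vn -> v1 y = v y by move=> h; rewrite /v1 sem_inc upd_neq.
have hm : size s <= N by lia.
have [|||p ep] := @decode_loop x s v1 pre post N ew hv1 x0 xn xt xz _ _ _ hm;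
  try by rewrite v1N.
rewrite ep sem_clear; last first.
  by rewrite -ep; apply: bounded_iter => // v0; apply: bounded_sem.
rewrite sem_inc upd_neq // upd_eq e1 mul1n v1N // vx0 add0n.
have -> : minn N (size pre + size s).+1 = size pre + (size s).+1 by lia.
apply: functional_extensionality => y; rewrite /v1 sem_inc /upd.
case: (y =P 0) => // _; case: (y =P vn) => // ->.
by rewrite (negPf nx) vn0.
Qed.

(** * Processing the rows of the adjacency matrix *)

Section Rows.
Variables K A B C : nat.
Hypotheses (hK : K <= N) (hB : B <= N) (hAC : A + C <= N).

Definition St q D bad i j n r t e s u d : nat -> nat :=
  nth 0 [:: q; K; A; B; C; D; bad; i; j; n; r; t; e; s; u; d; 0].

Lemma holds_bit b b' q D bad i j n r t e s u d pre post :
  w = pre ++ bit b :: post -> q = size pre ->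
  holds w (Letter (bit b')) (St q D bad i j n r t e s u d) = (b == b').
Proof.
by move=> ew ->; rewrite /= [in onth _]ew onth_mid -(inj_eq bit_inj).
Qed.

Lemma holds_stop b q D bad i j n r t e s u d pre post :
  w = pre ++ stop :: post -> q = size pre ->
  holds w (Letter (bit b)) (St q D bad i j n r t e s u d) = false.
Proof.
move=> ew ->; rewrite /= [in onth _]ew onth_mid.
exact: stop_bit.
Qed.

Lemma read_loop (row : seq bool) pre post D bad i j n r m :
  w = pre ++ delim row ++ post -> n + size row <= N -> r + size row <= N ->
  size row <= m ->
  iter m (sem w read_step) (St (size pre) D bad i j n r 0 0 0 0 0) =
  St (size pre + size row) D bad i (j - size row) (n + count id row)
    (r + count id (take j row)) 0 0 0 0 0.
Proof.
elim: row pre j n r m => [|b row IH] pre j n r m ew hn hr hm.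
  rewrite iter_fix ?addn0 ?subn0 //=.
  by rewrite /read_step !sem_if !(holds_stop _ _ _ _ _ _ _ _ _ _ _ _ ew).
case: m hm => // m hm; rewrite iterSr /=.
have hq : (size pre).+1 <= N.
  by rewrite ew size_cat /= addnS ltnS leq_addr.
have -> : sem w read_step (St (size pre) D bad i j n r 0 0 0 0 0) =
    St (size pre).+1 D bad i j.-1 (n + b) (r + (b && (0 < j))) 0 0 0 0 0.
  rewrite /= in hn hr.
  rewrite /read_step !sem_if !(holds_bit _ _ _ _ _ _ _ _ _ _ _ _ ew) //.
  case: b {ew hm} => /=; last first.
    rewrite sem_seq /St dec_nth inc_nth /= !addn0.
    by rewrite (minn_idPr hq).
  rewrite !sem_seq sem_if /St inc_nth /=.
  have -> : minn N n.+1 = n + 1 by lia.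
  case: j => [|j] /=.
    by rewrite dec_nth inc_nth /= (minn_idPr hq) addn0.
  rewrite inc_nth dec_nth inc_nth /= (minn_idPr hq).
  by have -> : minn N r.+1 = r + 1 by lia.
have := IH (rcons pre (bit b)) j.-1 (n + b) (r + (b && (0 < j))) m.
rewrite size_rcons /= in hn hr hm * => ->.
- rewrite addSnnS; congr (St _ _ _ _ _ _ _ _ _ _ _ _).
  + by lia.
  + by rewrite addnA.
  + by case: j => [|j] /=; rewrite ?take0 ?andbT ?andbF /= ?addn0 ?addnA.
- by rewrite cat_rcons.
- by case: b {ew} ; lia.
- by case: b {ew} ; lia.
- by [].
Qed.

Lemma split_step_pos q D bad i n r t e : 0 < t ->
  q <= N -> D <= N -> bad <= N -> i <= N -> n <= N -> r <= N -> t <= N -> e <= N ->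
  sem w split_step (St q D bad i 0 n r t e 0 0 0) =
  St q D (minn N (bad + (A - e))) i 0 n r (t - B) (e - A) 0 0 0.
Proof.
move=> t0 hq hD hbad hi hn hr ht he.
rewrite /split_step sem_if /= (gtn_eqF t0) sem_seq sub_nth //; last by rewrite /=; lia.
rewrite /= sem_for //; last by apply: bounded_nth => /=; lia.
move: (t - B) => t'; rewrite /=.
suff it k : k <= A -> iter k (sem w (ifz ve (inc vbad) (dec ve)))
    (St q D bad i 0 n r t' e 0 0 0) =
    St q D (minn N (bad + (k - e))) i 0 n r t' (e - k) 0 0 0 by apply: it.
elim: k => [|k IH] hk /=; first by rewrite sub0n subn0 addn0 (minn_idPr hbad).
rewrite IH ?(ltnW hk) // sem_if /St inc_nth dec_nth /=.
by case: ifP => /eqP h; congr (nth _ [:: _, _, _, _, _, _, _, _, _, _, _, _, _, _ & _]); lia.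
Qed.

(** The condition on [k] says that [vt] is still positive at the start of each of the [m] rounds. *)
Lemma split_iter q D bad i n r m :
  q <= N -> D <= N -> bad <= N -> i <= N -> n <= N -> r <= N ->
  (forall k, k < m -> k * B < n) ->
  iter m (sem w split_step) (St q D bad i 0 n r n n 0 0 0) =
  St q D (minn N (bad + (m * A - n))) i 0 n r (n - m * B) (n - m * A) 0 0 0.
Proof.
move=> hq hD hbad hi hn hr; elim: m => [|m IH] hm /=.
  by rewrite !mul0n !subn0 sub0n addn0 (minn_idPr hbad).
rewrite IH; last by move=> k hk; apply: hm; rewrite ltnW.
have h := hm m (ltnSn m).
rewrite split_step_pos ?geq_minl //; try lia.
by rewrite !mulSn; congr (St _ _ _ _ _ _ _ _ _ _ _ _); lia.
Qed.

Lemma sem_split q D bad i n r :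
  q <= N -> D <= N -> bad <= N -> i <= N -> 0 < n <= N -> r <= N ->
  exists bad' t' e', [/\ bad' <= N, t' <= N & e' <= N] /\
  [/\ sem w (ifz vt skip (inc vbad))
        (iter N (sem w split_step) (St q D bad i 0 n r n n 0 0 0)) =
      St q D bad' i 0 n r t' e' 0 0 0,
      (bad' == 0) = (bad == 0) && feasible A B n
    & feasible A B n -> e' = n - nparts B n * A].
Proof.
move=> hq hD hbad hi /andP [n0 hn] hr; rewrite /feasible.
have N0 : 0 < N by lia.
(* For [B = 0] the counter [vt] never shrinks, and the test after the loop raises [vbad]. *)
have [B0|B0] := posnP B.
  rewrite split_iter //; last by rewrite B0 => k; rewrite muln0.
  rewrite B0 muln0 subn0 sem_if /= (gtn_eqF n0) /St inc_nth /=.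
  eexists _, n, (n - N * A); split; last by split=> //=; rewrite ?andbF; lia.
  by split=> //; lia.
have nm : nparts B n <= N.
  by rewrite nparts_le // (leq_trans hn) // leq_pmulr.
(* Exactly [nparts B n] of the [N] rounds are active. *)
rewrite -[X in iter X](subnK nm) iterD split_iter //; last first.
  by move=> k; rewrite nparts_gt.
have -> : n - nparts B n * B = 0 by apply/eqP; rewrite subn_eq0 nparts_ub.
rewrite iter_fix; last by rewrite /split_step sem_if.
rewrite sem_if /=; eexists _, 0, _; split; last first.
  by split; [reflexivity| lia | ].
by split; lia.
Qed.

Lemma locate_step0 q D bad i n r e :
  q <= N -> D <= N -> bad <= N -> i <= N -> n <= N -> r <= N -> e <= N ->
  sem w locate_step (St q D bad i 0 n r 0 e 0 0 0) =
  if A + minn C e <= r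
  then St q (minn N (D + (A + minn C e))) bad i 0 n (r - (A + minn C e)) 0 (e - C) 0 0 0
  else St q D bad i 0 n r 0 (e - C) 0 0 1.
Proof.
move=> hq hD hbad hi hn hr he.
rewrite /locate_step sem_if /= !sem_seq /St add_nth //=; last by lia.
rewrite sem_for //; last by apply: bounded_nth => /=; lia.
have -> : minn N (0 + A) = A by lia.
have it k : k <= C -> iter k (sem w (ifz ve skip (dec ve ;; inc vs)))
    (St q D bad i 0 n r 0 e A 0 0) =
    St q D bad i 0 n r 0 (e - k) (A + minn k e) 0 0.
  elim: k => [|k IH] hk /=; first by rewrite subn0 min0n addn0.
  rewrite IH ?(ltnW hk) // sem_if sem_seq /St dec_nth inc_nth /=.
  by case: ifP => /eqP h; congr (nth _ [:: _, _, _, _, _, _, _, _, _, _, _, _, _, _ & _]); lia.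
rewrite [iter _ _ _]it // /St; set s := A + minn C e.
have hs : s <= N by rewrite /s; lia.
rewrite add_nth //=; last by lia.
have -> : minn N (0 + s) = s by lia.
rewrite sub_nth //=; last by lia.
rewrite sem_if /= subn_eq0; case: ifP => h.
  rewrite sem_seq sub_nth //=; last by lia.
  rewrite add_nth //=; last by lia.
  by rewrite clear_nth //= ?clear_nth //=; lia.
rewrite inc_nth /= clear_nth //= ?clear_nth //=; last by lia.
by have -> : minn N 1 = 1 by lia.
Qed.

(** The bounds hold unconditionally, since the run has to continue from a legal store after an
    infeasible row too. *)
Lemma locate_loop k q D bad i n r e m :
  q <= N -> D <= N -> bad <= N -> i <= N -> n <= N -> r <= N -> e <= N ->
  exists D' r' e' d', [/\ D' <= N, r' <= N, e' <= N & d' <= N] /\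
    iter k (sem w locate_step) (St q D bad i 0 n r 0 e 0 0 0) =
      St q D' bad i 0 n r' 0 e' 0 0 d' /\
    (r < sumn (parts A C m e) -> m <= k ->
      D' = minn N (D + start (parts A C m e) r)).
Proof.
move=> hq + hbad hi hn; elim: k D r e m => [|k IH] D r e m hD hr he.
  by exists D, r, e, 0; do 2!split=> //; case: m.
rewrite iterSr locate_step0 //; case: ifP => h; last first.
  rewrite iter_fix; last by rewrite /locate_step sem_if.
  exists D, r, (e - C), 1; do 2?split=> //; try lia.
  by case: m => //= m _ _; rewrite ltnNge h /= addn0; lia.
have [|||D' [r' [e' [d' [bnd [-> hD']]]]]] :=
  IH (minn N (D + (A + minn C e))) (r - (A + minn C e)) (e - C) m.-1; try lia.
exists D', r', e', d'; do 2?split=> //.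
case: m hD' => //= m hD' hr' hm; rewrite ltnNge h /= hD' //; lia.
Qed.

Hypothesis hC : C = B - A.

Lemma sem_row (row : seq bool) pre post D bad i :
  w = pre ++ delim row ++ post -> size row < N -> i < N -> D <= N -> bad <= N ->
  exists D' bad', [/\ D' <= N & bad' <= N] /\
  [/\ sem w row_step (St (size pre) D bad i 0 0 0 0 0 0 0 0) =
      St (size pre + (size row).+1) D' bad' i.+1 0 0 0 0 0 0 0 0,
      (bad' == 0) = (bad == 0) && feasible A B (count id row).+1
    & feasible A B (count id row).+1 ->
      D' = minn N (D + start (sizes A B (count id row).+1) (count id (take i row)))].
Proof.
move=> ew hrow hi hD hbad.
have hq : size pre + (size row).+1 <= N.
  by rewrite ew !size_cat size_rcons size_map addnA leq_addr.
have hn : count id row < N by apply: leq_ltn_trans (count_size _ _) hrow.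
have hr : count id (take i row) <= count id row.
  by rewrite -{2}(cat_take_drop i row) count_cat leq_addr.
rewrite /row_step !sem_seq (sem_rep _ read_step) (sem_rep _ split_step).
rewrite (sem_rep _ locate_step) /St add_nth //=; last by lia.
rewrite inc_nth /=.
have -> : minn N (0 + i) = i by lia.
have -> : minn N 1 = 1 by lia.
rewrite [iter _ (sem w read_step) _](@read_loop row pre post D bad i i 1 0 N ew) //;
  try lia.
rewrite /St inc_nth /= clear_nth /=; last by lia.
have -> : minn N (size pre + size row).+1 = size pre + (size row).+1 by lia.
rewrite add1n add0n add_nth //=; last by lia.
rewrite add_nth //=; last by lia.
set n := (count id row).+1 in hr *; set r := count id (take i row) in hr *.
have hnN : 0 < n <= N by rewrite /n.
have -> : minn N (0 + n) = n by lia.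
have [||||||bad' [t' [e' [[hbad' ht' he'] [-> ebad ee]]]]] :=
  @sem_split (size pre + (size row).+1) D bad i n r; try lia.
rewrite /St clear_nth //=.
have [|||||||D' [r' [e2 [d' [[hD' hr' he2 hd'] [-> eD]]]]]] :=
  @locate_loop N (size pre + (size row).+1) D bad' i n r e' (nparts B n);
  try lia.
rewrite /St clear_nth /=; last by lia.
rewrite clear_nth //= clear_nth //= clear_nth //= inc_nth /=.
rewrite (minn_idPr hi).
exists D', bad'; do !split=> //.
move=> feas; rewrite /sizes -(ee feas) -hC eD //.
  by rewrite ee // hC -/(sizes A B n) sumn_sizes //; lia.
by case/andP: feas => B0 _; rewrite nparts_le //; nia.
Qed.

Fixpoint row_total i (rows : seq (seq bool)) : nat :=
  if rows is row :: rows' then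
    start (sizes A B (count id row).+1) (count id (take i row)) + row_total i.+1 rows'
  else 0.

(** A row is recognised by its first bit, so rows must be nonempty. Behind the last row no letter is
    read and the remaining rounds do nothing. *)
Lemma rows_loop (rows : seq (seq bool)) pre D bad i m :
  w = pre ++ flatten (map delim rows) ->
  all (fun row => 0 < size row < N) rows -> i + size rows <= N -> D <= N ->
  bad <= N -> size rows <= m ->
  exists D' bad', [/\ D' <= N & bad' <= N] /\
  [/\ iter m (sem w (ifl true row_step (ifl false row_step skip)))
        (St (size pre) D bad i 0 0 0 0 0 0 0 0) =
      St N D' bad' (i + size rows) 0 0 0 0 0 0 0 0,
      (bad' == 0) = (bad == 0) && all (fun row => feasible A B (count id row).+1) rows
    & all (fun row => feasible A B (count id row).+1) rows ->
      D' = minn N (D + row_total i rows)].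
Proof.
elim: rows pre D bad i m => [|row rows IH] pre D bad i m ew /=.
  rewrite cats0 in ew => _ _ hD hbad _; exists D, bad; rewrite andbT addn0.
  split=> //; split=> [||_]; [|by []|by lia].
  rewrite -ew iter_fix // !sem_if /=.
  by rewrite onthE nth_default ?size_map.
case/andP=> /andP [row0 hrow] hrows hi hD hbad.
case: m => // m hm; rewrite iterSr.
have -> : sem w (ifl true row_step (ifl false row_step skip))
    (St (size pre) D bad i 0 0 0 0 0 0 0 0) =
    sem w row_step (St (size pre) D bad i 0 0 0 0 0 0 0 0).
  case: row row0 ew {hrow} => // b row _ ew.
  by rewrite !sem_if !(holds_bit _ _ _ _ _ _ _ _ _ _ _ _ ew) //; case: b {ew}.
have hi' : i < N by lia.
have [D1 [bad1 [[hD1 hbad1] [-> ebad1 eD1]]]] := sem_row ew hrow hi' hD hbad.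
have e1 : size pre + (size row).+1 = size (pre ++ delim row).
  by rewrite size_cat size_rcons size_map.
have [||||||D2 [bad2 [bnd [st2 ebad2 eD2]]]] :=
  IH (pre ++ delim row) D1 bad1 i.+1 m; rewrite ?catA //; first by rewrite -catA.
  by rewrite addSnnS.
exists D2, bad2; split=> //; split.
- by rewrite e1 st2 addSnnS.
- by rewrite ebad2 ebad1 andbA.
by case/andP=> f1 f2; rewrite eD2 // eD1 //; lia.
Qed.

End Rows.

Lemma sem_prog k a b (rows : seq (seq bool)) :
  w = delim k ++ delim a ++ delim b ++ flatten (map delim rows) ->
  all (fun row => 0 < size row < N) rows -> size rows <= N ->
  let A := minn N (bval a) in let B := minn N (bval b) in
  (sem w prog (fun _ => 0) vbad == 0) =
  all (fun row => feasible A B (count id row).+1) rows &&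
  (minn N (row_total A B 0 rows) <= minn N (bval k)).
Proof.
move=> ew hrows hsz A B; set K := minn N (bval k).
have [hA hB hK] : [/\ A <= N, B <= N & K <= N] by rewrite !geq_minl.
have e0 : (fun _ => 0) = nth 0 (nseq 17 0).
  by apply: functional_extensionality => x; rewrite nth_nseq if_same.
have hall s : all (leq^~ N) s -> bounded N (nth 0 s) by apply: bounded_nth.
rewrite /prog 7!sem_seq e0.
rewrite (@sem_decode vK k _ [::] _ ew) //; last exact: hall.
rewrite !upd_nth /= -/K add0n.
have ewa : w = delim k ++ delim a ++ (delim b ++ flatten (map delim rows)).
  by [].
have ewb : w = (delim k ++ delim a) ++ delim b ++ flatten (map delim rows).
  by rewrite -catA.
have sz s : size (delim s) = (size s).+1 by rewrite size_rcons size_map.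
have szw : N = (size k).+1 + (size a).+1 + (size b).+1 +
    size (flatten (map delim rows)) by rewrite ew !size_cat !sz !addnA.
rewrite (@sem_decode vA a _ (delim k) _ ewa) //; try by rewrite /= sz.
2: by apply: hall => /=; lia.
rewrite !upd_nth /= -/A.
rewrite (@sem_decode vB b _ (delim k ++ delim a) _ ewb) //; try by rewrite /= size_cat !sz.
2: by apply: hall => /=; rewrite sz; lia.
rewrite !upd_nth /= -/B -!sz -size_cat.
rewrite add_nth //=; last by rewrite !size_cat !sz; lia.
rewrite sub_nth //=; last by rewrite !size_cat !sz; lia.
rewrite add0n (minn_idPr hB) sem_rep.
have hAC : A + (B - A) <= N by lia.
rewrite catA in ewb.
have [|||D [bad [[hD hbad] [st eb eD]]]] :=
  @rows_loop K A B (B - A) hK hB hAC erefl rows _ 0 0 0 N ewb hrows _ _ _ hsz => //.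
rewrite [iter _ _ _]st /St sub_nth //=; last by lia.
rewrite add_nth //=; last by lia.
have -> : (minn N (bad + (D - K)) == 0) = (bad == 0) && (D <= K) by lia.
by rewrite eb /=; case: all eD => //= ->.
Qed.

End Word.
End Program.

(** The first bit is the parity of [n]; the others are the first bits of [n./2]. *)
Lemma bval_mkseq n m : bval (mkseq (fun i => odd (n %/ 2 ^ i)) m) = n %% 2 ^ m.
Proof.
elim: m n => [|m IH] n; first by rewrite modn1.
rewrite /mkseq /= (iotaDl 1 0) -map_comp expn0 divn1.
rewrite (eq_map (g := fun i => odd (n./2 %/ 2 ^ i))) => [|i]; last first.
  by rewrite /= -divn2 -divnMA -expnS.
rewrite -/(mkseq _ m) IH expnS.
have h : n./2 = n./2 %/ 2 ^ m * 2 ^ m + n./2 %% 2 ^ m by apply: divn_eq.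
have l : n./2 %% 2 ^ m < 2 ^ m by rewrite ltn_mod expn_gt0.
have e := odd_double_half n; move: h l.
move: (n./2 %% _) (n./2 %/ _) => r q h l.
have -> : n %% (2 * 2 ^ m) = (q * (2 * 2 ^ m) + (odd n + r.*2)) %% (2 * 2 ^ m).
  by congr (_ %% _); rewrite -[LHS]e h; lia.
by rewrite modnMDl modn_small //; case: (odd n); lia.
Qed.

Lemma bval_bits n : bval (bits n) = n.
Proof. by rewrite bval_mkseq modn_small // trunc_log_ltn. Qed.

(** * From the encoded rows back to the graph *)

Section Encoding.
Variables (n : nat) (G : sgraph 'I_n).

Lemma count_row x : count id (adj_row G x) = degree G x.
Proof.
rewrite count_map -sum1_count /degree -sum1_card big_enum_cond /=.
by apply: eq_bigl => y; rewrite inE.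
Qed.

(** The enumeration of ['I_n] is increasing, so the first [x] entries belong to the vertices below
    [x]. *)
Lemma count_take_row (x : 'I_n) : count id (take x (adj_row G x)) = lower_degree G x.
Proof.
rewrite -map_take count_map -size_filter.
rewrite -(card_uniqP (filter_uniq _ (take_uniq _ (enum_uniq _)))).
apply: eq_card => y; rewrite mem_filter in_take ?mem_enum // index_enum_ord.
by rewrite [RHS]inE.
Qed.

Definition rows := [seq adj_row G x | x <- enum 'I_n].

Lemma total_nth a b i (s : seq (seq bool)) : row_total a b i s =
  \sum_(k < size s) start (sizes a b (count id (nth [::] s k)).+1)
                          (count id (take (i + k) (nth [::] s k))).
Proof.
elim: s i => [|r s IH] i; first by rewrite big_ord0.
rewrite big_ord_recl /= addn0 IH; congr (_ + _).
by apply: eq_bigr => k _; rewrite addSnnS.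
Qed.

Lemma total_rows a b : row_total a b 0 rows = \sum_x place a b G x.
Proof.
rewrite total_nth size_map size_enum_ord; apply: eq_bigr => x _.
rewrite (nth_map x) ?size_enum_ord // nth_ord_enum add0n.
by rewrite count_row count_take_row.
Qed.

Lemma place_le a b x : place a b G x <= n.
Proof.
apply: leq_trans (start_le _ _) _.
by rewrite -[X in _ <= X]card_ord max_card.
Qed.

Lemma all_rows (P : nat -> bool) :
  all (fun row => P (count id row).+1) rows <-> forall x, P (degree G x).+1.
Proof.
rewrite all_map; split=> [/allP h x|h].
  by have := h x; rewrite mem_enum /= count_row => /(_ isT).
by apply/allP => x _ /=; rewrite count_row.
Qed.

Lemma size_rows : size (flatten [seq delimit r | r <- rows]) = n * n.+1.
Proof.
rewrite size_flatten /shape -map_comp sumnE big_map big_map big_enum /=.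
rewrite (eq_bigr (fun _ => n.+1)); first by rewrite sum_nat_const card_ord.
by move=> x _; rewrite size_rcons 2!size_map size_enum_ord.
Qed.

End Encoding.

(** Components have at most [n < N] vertices, so saturating the size bounds at [N] changes
    nothing. *)
Lemma card_constrained_cap n (G : sgraph 'I_n) a b N : n < N ->
  card_constrained (minn N a) (minn N b) G <-> card_constrained a b G.
Proof.
move=> hN; split=> h H /h; have : #|H| <= n by rewrite -[X in _ <= X]card_ord max_card.
  by lia.
by lia.
Qed.

Theorem prog_correct (I : cccd_instance) : cluster_graph (graph I) ->
  sem (encode_cccd I) (prog (Some : bool -> letter)) (fun _ => 0) 6 == 0 <-> cccd_yes I.
Proof.
case: I => n G k a b /= cG; set w := encode_cccd _.
have ew : w = delimit (bits k) ++ delimit (bits a) ++ delimit (bits b) ++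
    flatten [seq delimit r | r <- rows G].
  by rewrite /w /encode_cccd /rows -[in RHS](map_comp delimit).
have szw : n * n.+1 + 3 <= size w.
  by rewrite ew !size_cat size_rows !size_rcons; lia.
have nw : n < size w by nia.
have hrows : all (fun row => 0 < size row < size w) (rows G).
  apply/allP => r /mapP [x _ ->]; rewrite size_map size_enum_ord nw andbT.
  by case: (n) x => // -[].
rewrite (sem_prog (stop := None) _ _ ew) //; last first.
- by rewrite size_map size_enum_ord ltnW.
- by move=> x y [].
rewrite !bval_bits total_rows.
set A := minn _ a; set B := minn _ b.
have le : \sum_x place A B G x <= size w.
  apply: (@leq_trans (n * n)); last by nia.
  rewrite -[X in X * _]card_ord -sum_nat_const.
  by apply: leq_sum => x _; apply: place_le.
(* The total is at most [n * n], hence below the length of the word, and saturation does not affect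
   the comparison. *)
have -> : (minn (size w) (\sum_x place A B G x) <= minn (size w) k) =
    (\sum_x place A B G x <= k) by lia.
rewrite -(rwP andP) all_rows -cluster_deletion_criterion // /cccd_yes /=.
split=> -[F [sF cF cD hD]]; exists F; split=> //.
  exact/(card_constrained_cap _ _ _ nw).
exact/(card_constrained_cap _ _ _ nw).
Qed.

Theorem mainTheorem15 :
  poly_time_solvable_on encode_cccd cccd_yes
    (fun I : cccd_instance => cluster_graph (graph I)).
Proof.
(* Counter [16] is [vz], the highest one in use, and counter [6] is [vbad]. *)
apply: (poly_time_of_com (K := 16) (c := prog (Some : bool -> letter)) (out := 6)).
- exact: wf_prog.
- by [].
- by move=> I _; rewrite /encode_cccd size_cat size_rcons.
- exact: prog_correct.
Qed.
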